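(* Consider the Ising model on $\mathbb{Z}^d$ with inverse temperature $\beta>0$ and magnetic field $h\in\mathbb{R}$, such that either $h>h(d)$, or $h=0$ and $\beta<\beta_1(d)$, or $h=0$ and $\beta>\beta_2(d)$. Let $\omega=(\sigma_i)_{i\in\mathbb{Z}^d}$ be distributed according to $\mu_{\beta,h}$, let $\Lambda_n:=[-n,n]^d\cap\mathbb{Z}^d$, $S_n:=\sum_{i\in\Lambda_n}\sigma_i$ and $Z_n:=\frac{S_n-\mathbb{E}_{\beta,h}(S_n)}{\sqrt{\mathbb{V}_{\beta,h}(S_n)}}$, with expectation and variance taken under $\mu_{\beta,h}$. Let $N$ be a standard normally distributed random variable. Then for every even $k\ge4$ there is a constant $C_1(k)$, not depending on $n$, such that for all $n\ge1$ $$\bigl|\mathbb{E}_{\beta,h}(Z_n^k)-\mathbb{E}(N^k)\bigr|\le C_1(k)\,\frac1{(2n+1)^d}.$$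
   Context: Ising measure: for finite $\Lambda\subset\mathbb{Z}^d$, the Gibbs measure with $+$ boundary condition $\mu^+_{\Lambda,\beta,h}$ is the probability measure on $\{\omega=(\sigma_i)_{i\in\mathbb{Z}^d}\in\{-1,+1\}^{\mathbb{Z}^d}:\sigma_i=+1\ \forall i\notin\Lambda\}$ with weights proportional to $\exp(-H_{\Lambda,\beta,h}(\omega))$, where $$H_{\Lambda,\beta,h}(\omega)=-\beta\sum_{\{i,j\}\subset\mathbb{Z}^d:\ \|i-j\|_1=1,\ \{i,j\}\cap\Lambda\ne\emptyset}\sigma_i\sigma_j-h\sum_{i\in\Lambda}\sigma_i .$$ For increasing finite sets $\Lambda_n$ with $\bigcup_n\Lambda_n=\mathbb{Z}^d$ the measures $\mu^+_{\Lambda_n,\beta,h}$ converge weakly to a probability measure on $\{-1,+1\}^{\mathbb{Z}^d}$, denoted $\mu_{\beta,h}$. Joint cumulants: for random variables $X_1,\dots,X_j$ with finite moments, $\Gamma(X_1,\dots,X_j)$ is the coefficient of $t_1\cdots t_j$ in the (formal) power series expansion of $\log\mathbb{E}\exp(t_1X_1+\cdots+t_jX_j)$. Constants: $h(d),\beta_1(d),\beta_2(d)>0$ and $0<\varepsilon(d)<1$ are constants depending only on the dimension $d$ with the following property (their existence is a known result from the literature). Whenever $h>h(d)$, or $h=0$ and $\beta<\beta_1(d)$, or $h=0$ and $\beta>\beta_2(d)$, then for every $j\ge1$ there is a constant $C_j$ such that for all $A=\{i_1,\dots,i_j\}\subset\mathbb{Z}^d$ the joint cumulant under $\mu_{\beta,h}$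 satisfies $$|\Gamma^{\beta,h}(\sigma_{i_1},\dots,\sigma_{i_j})|\le C_j\,\varepsilon(d)^{l_T(A)},$$ where $l_T(A)$ is the minimum length (number of edges) of a tree in the nearest-neighbour graph of $\mathbb{Z}^d$ connecting the vertices of $A$ (repetitions among $i_1,\dots,i_j$ are allowed). *)

(* Defs.v *)
From HB Require Import structures.
From mathcomp Require Import all_boot all_order all_algebra finmap.
From mathcomp Require Import all_classical all_reals all_analysis.

Set Implicit Arguments.
Unset Strict Implicit.
Unset Printing Implicit Defensive.

Import Order.TTheory GRing.Theory Num.Theory.
Import numFieldNormedType.Exports.

Local Open Scope classical_set_scope.
Local Open Scope ring_scope.

Notation lattice d := {ffun 'I_d -> int}.

Definition l1dist d (x y : lattice d) : int := \sum_(k < d) `|x k - y k|.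

(** [{-1,+1}^(Z^d)], the spin values +1 and -1 being encoded as [true] and
    [false] (see [spin]), with the product topology and its Borel
    sigma-algebra, which is also the one generated by the cylinders. *)
Definition config (d : nat) : Type := {ptws (lattice d) -> bool}.

HB.instance Definition _ d := Topological.copy (config d)
  {ptws (lattice d) -> bool}.
HB.instance Definition _ d := isPointed.Build (config d) (fun=> true).
HB.instance Definition _ d := @isMeasurable.Build
  (sigma_display (@open (config d))) (config d) <<s @open (config d)>>
  (@sigma_algebra0 _ setT _) (@sigma_algebraC _ _)
  (@sigma_algebra_bigcup _ setT _).

Definition spin (R : realType) (b : bool) : R := if b then 1 else -1.

Section gibbs.
Context {R : realType} {d : nat} (beta h : R) (L : {fset lattice d}).

(** A nearest-neighbour bond is the two-element set of its endpoints. *)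
Definition is_bond (e : {fset lattice d}) : Prop :=
  exists x y, l1dist x y = 1 /\ e = [fset x; y]%fset.

Definition bonds_meeting : set {fset lattice d} :=
  [set e | is_bond e /\ exists2 x, x \in e & x \in L].

Definition hamiltonian (w : config d) : R :=
  - beta * (\sum_(e \in bonds_meeting) \prod_(x <- e) spin R (w x))
  - h * (\sum_(x <- L) spin R (w x)).

Definition plus_configs : set (config d) :=
  [set w | forall x, x \notin L -> w x = true].

Definition partition_function : R :=
  \sum_(w \in plus_configs) expR (- hamiltonian w).

Definition gibbs_plus (A : set (config d)) : \bar R :=
  (\sum_(w \in plus_configs `&` A)
      expR (- hamiltonian w) / partition_function)%:E.

Lemma finite_plus_configs : finite_set plus_configs.
Proof.
pose ext (s : {ffun L -> bool}) : config d :=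
  fun x => if insub x is Some y then s y else true.
suff -> : plus_configs = ext @` [set: {ffun L -> bool}] by exact: finite_image.
apply/seteqP; split=> [w wp|_ [s _ <-] x xL] /=; last by rewrite /ext insubN.
exists [ffun y : L => w (val y)] => //; apply/funext => x; rewrite /ext.
by case: insubP => [y _ <-|/wp ->//]; rewrite ffunE.
Qed.

Lemma partition_function_gt0 : 0 < partition_function.
Proof.
rewrite /partition_function fsbig_finite /=; last exact: finite_plus_configs.
have p1 : ((fun=> true) : config d) \in fset_set plus_configs.
  by rewrite in_fset_set ?inE//; exact: finite_plus_configs.
rewrite (big_fsetD1 _ p1)/= ltr_wpDr ?expR_gt0//.
by apply: sumr_ge0 => w _; exact: expR_ge0.
Qed.

Let wt (w : config d) : R := expR (- hamiltonian w) / partition_function.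

Let wt_ge0 w : 0 <= wt w.
Proof. by rewrite divr_ge0 ?expR_ge0// ltW// partition_function_gt0. Qed.

Let s := enum_fset (fset_set plus_configs).
Let diracs (k : nat) : {measure set (config d) -> \bar R} :=
  mscale (NngNum (wt_ge0 (nth point s k))) (dirac (nth point s k)).

Let gibbs_plusE : gibbs_plus = msum diracs (size s).
Proof.
apply/funext => A; rewrite /gibbs_plus /msum.
have -> : \sum_(w \in plus_configs `&` A) wt w =
    \sum_(w \in plus_configs) wt w * \1_A w.
  rewrite fsbig_mkcondr; apply: eq_fsbigr => w _.
  by rewrite indicE; case: ifP; rewrite ?mulr1 ?mulr0.
rewrite fsbig_finite /=; last exact: finite_plus_configs.
by rewrite (big_nth point) big_mkord -sumEFin.
Qed.

Let gibbs_plus0 : gibbs_plus set0 = 0%E.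
Proof. by rewrite gibbs_plusE measure0. Qed.

Let gibbs_plus_ge0 A : (0 <= gibbs_plus A)%E.
Proof. by rewrite gibbs_plusE measure_ge0. Qed.

Let gibbs_plus_sigma_additive : semi_sigma_additive gibbs_plus.
Proof. by rewrite gibbs_plusE; exact: measure_semi_sigma_additive. Qed.

HB.instance Definition _ := isMeasure.Build _ _ _ gibbs_plus
  gibbs_plus0 gibbs_plus_ge0 gibbs_plus_sigma_additive.

Let gibbs_plus_setT : gibbs_plus setT = 1%E.
Proof.
have Z0 := lt0r_neq0 partition_function_gt0.
rewrite /gibbs_plus setIT; congr EFin.
rewrite fsbig_finite /=; last exact: finite_plus_configs.
rewrite -mulr_suml -fsbig_finite /=; last exact: finite_plus_configs.
exact: divff.
Qed.

HB.instance Definition _ := Measure_isProbability.Build _ _ _ gibbs_plus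
  gibbs_plus_setT.

End gibbs.

(** [mu] is [mu_{beta,h}]: the weak limit of the finite-volume measures along
    every increasing sequence of finite sets exhausting [Z^d]. *)
Definition is_plus_state (R : realType) d (beta h : R)
    (mu : probability (config d) R) : Prop :=
  forall L : nat -> {fset lattice d},
    (forall n, L n `<=` L n.+1)%fset ->
    (forall x, exists n, x \in L n) ->
  forall f : config d -> R, continuous f ->
    ('E_(gibbs_plus beta h (L n))[f] @[n --> \oo] --> 'E_mu[f])%E.

(** Formal power series in [t_1, ..., t_j], as families of coefficients
    indexed by the exponents of the monomials. *)
Definition mfps (R : Type) (j : nat) : Type := {ffun 'I_j -> nat} -> R.

Section mfps.
Context {R : realType} {j : nat}.
Implicit Types f g : mfps R j.

Definition mfps_one : mfps R j := fun a => (a == [ffun=> 0%N])%:R.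

Definition mfps_mul f g : mfps R j := fun a =>
  \sum_(p \in [set p : {ffun 'I_j -> nat} * {ffun 'I_j -> nat} |
               forall i, (p.1 i + p.2 i)%N = a i]) f p.1 * g p.2.

Definition mfps_pow f (m : nat) : mfps R j := iter m (mfps_mul f) mfps_one.

(** [log f = \sum_(m >= 1) (-1)^(m+1) / m * (f - 1)^m], for [f] of constant
    term 1: each coefficient is then a sum with finitely many nonzero terms,
    as [(f - 1)^m] only has monomials of total degree at least [m]. *)
Definition mfps_log f : mfps R j := fun a =>
  \sum_(m \in [set m : nat | (0 < m)%N])
    (-1) ^+ m.+1 / m%:R * mfps_pow (fun b => f b - mfps_one b) m a.

End mfps.

Section cumulant.
Context {disp : measure_display} {T : measurableType disp} {R : realType}.
Context (P : probability T R) {j : nat} (X : 'I_j -> T -> R).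

(** [E exp (t_1 X_1 + ... + t_j X_j)], expanded in the [t_i]. *)
Definition mgf_series : mfps R j := fun a =>
  fine ('E_P[fun w => (\prod_(i < j) X i w ^+ a i)%R])%E
    / (\prod_(i < j) (a i)`!)%:R.

Definition joint_cumulant : R := mfps_log mgf_series [ffun=> 1%N].

End cumulant.

Section tree_length.
Context {d : nat}.

Definition bond_adj (E : {fset {fset lattice d}}) : rel (lattice d) :=
  fun x y => [fset x; y]%fset \in E.

(** Vertices [V] and bonds [E] form a tree: a nonempty connected subgraph of
    the nearest-neighbour graph without simple cycles ([cycle] counts a bond
    run back and forth as a cycle of size 2). *)
Definition is_tree (V : {fset lattice d}) (E : {fset {fset lattice d}}) :=
  [/\ V != fset0,
      forall e, e \in E -> exists x y,
        [/\ x \in V, y \in V, l1dist x y = 1 & e = [fset x; y]%fset],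
      forall x y, x \in V -> y \in V ->
        exists2 p, path (bond_adj E) x p & last x p = y
    & forall p, cycle (bond_adj E) p -> uniq p -> (size p <= 2)%N].

Definition tree_length (A : {fset lattice d}) : nat := xget 0%N
  [set m | (exists V E, [/\ is_tree V E, (A `<=` V)%fset & #|`E|%fset = m]) /\
           (forall V E, is_tree V E -> (A `<=` V)%fset -> (m <= #|`E|%fset)%N)].

End tree_length.

Definition in_regime (R : realType) (hd b1 b2 beta h : R) : Prop :=
  [\/ hd < h, h = 0 /\ beta < b1 | h = 0 /\ b2 < beta].

Definition cumulant_decay (R : realType) (d : nat) (hd b1 b2 eps : R) : Prop :=
  forall beta h : R, 0 < beta -> in_regime hd b1 b2 beta h ->
  forall mu : probability (config d) R, is_plus_state beta h mu ->
  forall j : nat, (0 < j)%N -> exists Cj : R,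
  forall x : 'I_j -> lattice d,
    `|joint_cumulant mu (fun k (w : config d) => spin R (w (x k)))|
      <= Cj * eps ^+ tree_length [fset x k | k in 'I_j]%fset.

Section magnetization.
Context {R : realType} {d : nat}.

Definition box (n : nat) : set (lattice d) :=
  [set x | forall k, `|x k| <= n%:Z].

Definition magnetization (n : nat) (w : config d) : R :=
  \sum_(x \in box n) spin R (w x).

Definition normalized_magnetization (mu : probability (config d) R) (n : nat)
    (w : config d) : R :=
  (magnetization n w - fine ('E_mu[magnetization n])%E)
    / Num.sqrt (fine 'V_mu[magnetization n]).

End magnetization.

(* Main.v *)
(** The moments and cumulants of [S_n] satisfy
    [E (S_n^(k+1)) = \sum_l 'C(k, l) kappa_(l+1) E (S_n^(k-l))], and this
    becomes, after centring and scaling, a recursion for the moments [z_k] of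
    [Z_n] with coefficients [lam_j = kappa_j / V(S_n)^(j/2)], where
    [lam_2 = 1].  The moments of [N] satisfy the same recursion with
    [lam_j = 0] for [j >= 3].

    By multilinearity [kappa_j] is a sum of joint cumulants of spins.  A tree
    containing [x_1, ..., x_j] has at least [max_i |x_1 - x_i|_1] edges, so the
    decay hypothesis makes this sum [O(v)], with [v = (2n+1)^d].  Conversely
    [V(S_n) >= c v], which is obtained in finite volume by testing [S_n] against
    a function whose Gibbs weight is antisymmetric under spin flips.  Hence
    [lam_j = O(v^(1-j/2))], and by induction on [k] the moment [z_k] differs
    from that of [N] by [O(1/v)] for even [k] and by [O(v^(-1/2))] for odd [k]:
    the parity is what rules out the error [v^(-1/2)] that [lam_3] alone would
    give. *)

Require Import Defs.
From HB Require Import structures.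
From mathcomp Require Import all_boot all_order all_algebra finmap.
From mathcomp Require Import all_classical all_reals all_analysis.
From mathcomp Require Import measurable_realfun.
From mathcomp Require Import zify ring lra.

Set Implicit Arguments.
Unset Strict Implicit.
Unset Printing Implicit Defensive.

Import Order.TTheory GRing.Theory Num.Theory.
Import numFieldNormedType.Exports.

Local Open Scope classical_set_scope.
Local Open Scope ring_scope.

(** * Coefficients of formal power series in degree at most one in each variable *)

(** The joint cumulant reads the logarithm of a series in several variables at one squarefree
    monomial, and only squarefree coefficients contribute to it. On these, the product is a
    convolution over subsets. Multilinearity follows because each index lies in exactly one of the
    two factors. The moment recursion follows because, for equal variables, the series depends on
    [t_1 + ... + t_j] only, and [M * (log M)' = M'] can be compared coefficient by coefficient.

    Decay bounds the cumulants from above only, so the lower bound on the variance needs another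
    source. It is finite energy: one spin flip changes the Hamiltonian by at most a constant
    independent of the volume. The resulting bound is therefore uniform in the volume and passes to
    the weak limit.

    All constants have to be fixed before [n]; this is why the comparison lemmas choose theirs
    before the random variable, its moments and its cumulants are quantified. *)

Section mfps_multilinear.
Context {R : realType} {j : nat}.
Implicit Types (f g h : mfps R j) (A B : {set 'I_j}) (p q : {poly R}).

(** Exponents of the squarefree monomial attached to [A]. Divisors of a squarefree monomial are
    squarefree, so these coefficients of a product depend only on the same coefficients of the
    factors. *)
Definition expind A : {ffun 'I_j -> nat} := [ffun i => (i \in A : nat)].

Lemma expind_inj : injective expind.
Proof.
move=> A B /ffunP AB; apply/setP => i.
by have := AB i; rewrite !ffunE; do 2 case: (_ \in _).
Qed.

Lemma mfps_one_expind A : mfps_one (expind A) = (A == finset.set0)%:R :> R.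
Proof.
rewrite /mfps_one; congr (_ %:R); congr nat_of_bool.
apply/eqP/eqP => [/ffunP A0|->]; last by apply/ffunP => i; rewrite !ffunE inE.
by apply/setP => i; have := A0 i; rewrite !ffunE inE; case: (_ \in _).
Qed.

Lemma mfps_mul_expind f g A : mfps_mul f g (expind A) =
  \sum_(B in powerset A) f (expind B) * g (expind (A :\: B)%SET).
Proof.
have split B : B \in powerset A -> forall i,
    (expind B i + expind (A :\: B)%SET i)%N = expind A i.
  rewrite powersetE => BA i; rewrite !ffunE !inE.
  have := fintype.subsetP BA i.
  by case: (i \in B); case: (i \in A) => // /(_ isT).
rewrite /mfps_mul.
rewrite (fsbigE [seq (expind B, expind (A :\: B)%SET) | B <- enum (powerset A)]).
- rewrite big_map big_enum_cond; apply: eq_bigl => B.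
  by apply: andb_idr => BA; rewrite inE; exact: split.
- by rewrite map_inj_uniq ?enum_uniq// => B C [/expind_inj].
- by move=> p /= /mapP[B]; rewrite mem_enum => BA -> /=; exact: split.
- move=> [a b] /= ab /negP[]; apply/mapP.
  exists [set i in 'I_j | a i == 1%N]%SET.
    rewrite mem_enum powersetE; apply/fintype.subsetP => i; rewrite !inE /=.
    by move=> /eqP ai; have := ab i; rewrite ffunE /= ai; case: (i \in A).
  have h i : a i = (a i == 1%N) /\ b i = (a i != 1%N) && (i \in A).
    have := ab i; rewrite ffunE; case: (i \in A) => /=; case: (a i) => [|[|n]];
    by case: (b i) => [|[|m]].
  by congr pair; apply/ffunP => i; have [hi1 hi2] := h i; rewrite !ffunE !inE.
Qed.

(** A nonzero contribution to the [m]-th power splits [A] into [m] disjoint nonempty blocks, which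
    needs at least [m] elements. *)
Lemma mfps_pow_expind0 f A m : f (expind finset.set0) = 0 -> (#|A| < m)%N ->
  mfps_pow f m (expind A) = 0.
Proof.
move=> f0; elim: m A => // m IH A Am.
rewrite /mfps_pow /= mfps_mul_expind big1// => B; rewrite powersetE => BA.
have [->|/set0Pn[i iB]] := eqVneq B finset.set0; first by rewrite f0 mul0r.
rewrite [X in _ * X]IH ?mulr0// -ltnS; apply: leq_trans Am.
rewrite ltnS; apply: proper_card.
apply/properP; split; first exact: finset.subsetDl.
by exists i; rewrite ?(fintype.subsetP BA)// !inE iB.
Qed.

Lemma mfps_log_expind f A N : f (expind finset.set0) = 1 -> (#|A| <= N)%N ->
  mfps_log f (expind A) = \sum_(1 <= m < N.+1) (-1) ^+ m.+1 / m%:R *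
    mfps_pow (fun b => f b - mfps_one b) m (expind A).
Proof.
move=> f1 AN; rewrite /mfps_log (fsbigE (index_iota 1 N.+1)).
- rewrite big_mkcond; apply: eq_big_seq => m.
  by rewrite mem_index_iota => /andP[m0 _]; rewrite mem_set.
- exact: iota_uniq.
- by move=> m /=; rewrite mem_index_iota => /andP[].
- move=> m /= m0; rewrite mem_index_iota m0/= -leqNgt => Nm.
  rewrite mfps_pow_expind0 ?mulr0 ?(leq_ltn_trans AN)//.
  by rewrite f1 mfps_one_expind eqxx subrr.
Qed.

(* [h] arises from [f] and [g] by replacing the [i]-th variable by a linear
   combination, all three series being considered in degree at most one. *)
Definition slot_comb (i : 'I_j) (a b : R) h f g := forall A,
  if i \in A then h (expind A) = a * f (expind A) + b * g (expind A)
  else h (expind A) = f (expind A) /\ h (expind A) = g (expind A).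

(** For [i] in [A], exactly one of [B] and its complement in [A] contains [i]. That factor is linear
    in the changed variable, and the other is common to the three series. *)
Lemma slot_comb_mul i a b h f g h' f' g' :
  slot_comb i a b h f g -> slot_comb i a b h' f' g' ->
  slot_comb i a b (mfps_mul h h') (mfps_mul f f') (mfps_mul g g').
Proof.
move=> H H' A; rewrite !mfps_mul_expind; case: ifPn => iA.
  rewrite !mulr_sumr -big_split/=; apply: eq_bigr => B; rewrite powersetE => BA.
  move: (H B) (H' (A :\: B)%SET); rewrite !inE iA andbT.
  case: (i \in B) => /=; [move=> -> [<- <-]|move=> [<- <-] ->]; ring.
by split; apply: eq_bigr => B; rewrite powersetE => BA;
  move: (H B) (H' (A :\: B)%SET); rewrite !inE (negPf iA) andbF;
  rewrite (contraNF (fintype.subsetP BA i) iA) => -[? ?] [? ?]; congr (_ * _).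
Qed.

Lemma slot_comb_pow i a b h f g m : slot_comb i a b h f g ->
  slot_comb i a b (mfps_pow h m.+1) (mfps_pow f m.+1) (mfps_pow g m.+1).
Proof.
move=> H.
have mul1 (u : mfps R j) A : mfps_mul u mfps_one (expind A) = u (expind A).
  rewrite mfps_mul_expind (bigD1 A)/= ?powersetE//.
  rewrite mfps_one_expind finset.setDv eqxx mulr1 big1 => [|B]; first by rewrite addr0.
  rewrite powersetE; move=> /andP[BA BNA]; rewrite mfps_one_expind.
  rewrite finset.setD_eq0; case: (boolP (A \subset B)) => [AB|_]; last by rewrite mulr0.
  by move: BNA; rewrite finset.eqEsubset BA AB.
elim: m => [A|m IH]; last exact: slot_comb_mul.
by rewrite /mfps_pow/= !mul1; exact: H.
Qed.

Lemma slot_comb_log i a b h f g : h (expind finset.set0) = 1 ->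
  slot_comb i a b h f g ->
  mfps_log h (expind [set: 'I_j]%SET) =
  a * mfps_log f (expind [set: 'I_j]%SET) +
  b * mfps_log g (expind [set: 'I_j]%SET).
Proof.
move=> h1 H; have := H finset.set0; rewrite inE => -[hf hg].
rewrite !(@mfps_log_expind _ _ #|[set: 'I_j]%SET|)// -?hf -?hg//.
rewrite !mulr_sumr -big_split; apply: eq_big_nat => m /andP[+ _].
case: m => // m _.
have H1 : slot_comb i a b (fun b => h b - mfps_one b) (fun b => f b - mfps_one b)
    (fun b => g b - mfps_one b).
  move=> A; move: (H A); case: ifP => [iA ->|_ [<- <-]//].
  rewrite mfps_one_expind; case: eqP => [A0|_]; last by rewrite !subr0.
  by rewrite A0 inE in iA.
have := slot_comb_pow m H1 [set: 'I_j]%SET; rewrite inE => ->.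
by rewrite mulrDr; congr (_ + _); exact: mulrCA.
Qed.

End mfps_multilinear.

(** * Moments and cumulants *)

Section exponential_generating.
Context {R : realType} {j : nat}.
Implicit Types (f g : mfps R j) (A : {set 'I_j}) (p q : {poly R}).

(* In degree at most one in each variable, [f] is the series
   [p (t_1 + ... + t_j)]. *)
Definition diagonal f p := forall A, f (expind A) = (#|A| `!)%:R * p`_#|A|.

Lemma sum_powerset_card (F : nat -> R) A :
  \sum_(B in powerset A) F #|B| = \sum_(b < #|A|.+1) 'C(#|A|, b)%:R * F b.
Proof.
pose c (B : {set 'I_j}) : 'I_(#|A|.+1) := inord #|B|.
rewrite (partition_big c xpredT)//=; apply: eq_bigr => b _.
rewrite -cards_draws -sum1_card natr_sum mulr_suml.
rewrite (eq_bigl (fun B => B \in [set B : {set 'I_j} | B \subset A & #|B| == b]%SET)).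
  by apply: eq_bigr => B; rewrite inE => /andP[_ /eqP ->]; rewrite mul1r.
move=> B; rewrite powersetE inE; case: (boolP (B \subset A)) => //= BA.
by rewrite -val_eqE /= inordK// ltnS subset_leq_card.
Qed.

(** Subsets of the same size contribute equally, and the factorials absorb the number of subsets of
    each size, which leaves the Cauchy product. *)
Lemma diagonal_mul f g p q : diagonal f p -> diagonal g q ->
  diagonal (mfps_mul f g) (p * q).
Proof.
move=> Hf Hg A; rewrite mfps_mul_expind coefM.
transitivity (\sum_(B in powerset A) (#|B| `!)%:R * p`_#|B| *
    (((#|A| - #|B|)`!)%:R * q`_(#|A| - #|B|))).
  apply: eq_bigr => B; rewrite powersetE => BA; rewrite Hf Hg cardsD.
  by rewrite (finset.setIidPr BA).
rewrite (sum_powerset_card (fun b => (b`!)%:R * p`_b *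
    (((#|A| - b)`!)%:R * q`_(#|A| - b)))) mulr_sumr.
apply: eq_bigr => b _; have bA : (b <= #|A|)%N by rewrite -ltnS.
rewrite -[in RHS](bin_fact bA) !natrM.
move: (b `!%:R) ((#|A| - b)`!%:R) => x y; ring.
Qed.

Lemma diagonal_one : diagonal mfps_one 1.
Proof.
move=> A; rewrite mfps_one_expind coef1 cards_eq0.
by case: eqP => [->|]; rewrite ?cards0 ?fact0 ?mulr1// mulr0.
Qed.

(** The order [N] of truncation is free above [j], so that a single polynomial can serve the
    cumulants of all orders up to [N]. *)
Lemma diagonal_log f p N : p`_0 = 1 -> (j <= N)%N -> diagonal f p ->
  mfps_log f (expind [set: 'I_j]%SET) = (j`!)%:R *
    (\sum_(1 <= m < N.+1) ((-1) ^+ m.+1 / m%:R) *: (p - 1) ^+ m)`_j.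
Proof.
move=> p1 jN Hf; rewrite (@mfps_log_expind _ _ _ _ N); last first.
- by rewrite cardsT card_ord.
- by rewrite Hf cards0 p1 mulr1.
have H1 : diagonal (fun b => f b - mfps_one b) (p - 1).
  by move=> A; rewrite Hf diagonal_one coefB mulrBr.
have Hm m : diagonal (mfps_pow (fun b => f b - mfps_one b) m) ((p - 1) ^+ m).
  elim: m => [|m IH]; first by rewrite expr0; exact: diagonal_one.
  by rewrite exprS; exact: diagonal_mul.
rewrite coef_sum mulr_sumr; apply: eq_bigr => m _.
by rewrite Hm coefZ cardsT card_ord mulrCA.
Qed.

End exponential_generating.

(** The truncated form of [p * (log p)' = p']: the derivative of the sum is [p'] times a geometric
    sum in [1 - p], and multiplication by [p = 1 - (1 - p)] telescopes it. *)
Lemma deriv_truncated_log (R : realType) (p : {poly R}) (N : nat) :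
  p * (\sum_(1 <= m < N.+1) ((-1) ^+ m.+1 / m%:R) *: (p - 1) ^+ m)^`() =
  p^`() * (1 - (1 - p) ^+ N).
Proof.
have -> : 1 - (1 - p) ^+ N = p * \sum_(i < N) (1 - p) ^+ i.
  rewrite -{1}(expr1n _ N) subrXX; congr (_ * _); first by rewrite opprB addrC subrK.
  by apply: eq_bigr => i _; rewrite expr1n mul1r.
rewrite mulrCA; congr (_ * _).
rewrite big_add1 big_mkord raddf_sum mulr_sumr; apply: eq_bigr => i _ /=.
rewrite derivZ deriv_exp derivB derivC subr0 /=.
rewrite -scalerMnr scalerMnl -mulr_natr.
rewrite divfK ?pnatr_eq0// -[1 - p]opprB (exprNn (p - 1)).
have -> : (-1) ^+ i.+2 = (-1) ^+ i :> R by rewrite !exprS mulrA mulrNN !mul1r.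
by rewrite -mul_polyC polyC_exp polyCN polyC1 mulrCA.
Qed.

Section moment_cumulant.
Context {disp : measure_display} {T : measurableType disp} {R : realType}.
Context (P : probability T R).

Lemma mgf_series_expind (j : nat) (X : 'I_j -> T -> R) (A : {set 'I_j}) :
  mgf_series P X (expind A) = fine ('E_P[fun w => (\prod_(i in A) X i w)%R])%E.
Proof.
rewrite /mgf_series [X in _ / X%:R]big1 ?divr1; last first.
  by move=> i _; rewrite ffunE; case: (i \in A).
congr (fine (expectation _ _)); apply/funext => w.
rewrite [RHS]big_mkcond/=; apply: eq_bigr => i _.
by rewrite ffunE; case: (i \in A); rewrite ?expr1 ?expr0.
Qed.

Lemma joint_cumulantE (j : nat) (X : 'I_j -> T -> R) :
  joint_cumulant P X = mfps_log (mgf_series P X) (expind [set: 'I_j]%SET).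
Proof.
by rewrite /joint_cumulant; congr mfps_log; apply/ffunP => i; rewrite !ffunE inE.
Qed.

Definition moment (Y : T -> R) (k : nat) : R := fine ('E_P[fun w => (Y w ^+ k)%R])%E.

Lemma moment_cumulant (Y : T -> R) (k : nat) : moment Y k.+1 =
  \sum_(l < k.+1) 'C(k, l)%:R * joint_cumulant P (fun _ : 'I_l.+1 => Y)
    * moment Y (k - l).
Proof.
(* Degrees up to [k.+1] suffice, since the identity between derivatives is compared in degree
   [k]. *)
pose p : {poly R} := \poly_(i < k.+2) (moment Y i / (i`!)%:R).
pose q : {poly R} := \sum_(1 <= m < k.+2) ((-1) ^+ m.+1 / m%:R) *: (p - 1) ^+ m.
have p0 : p`_0 = 1.
  rewrite coef_poly/= /moment; under eq_fun do rewrite expr0.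
  by rewrite expectation_cst fact0 divr1.
have pE i : (i < k.+2)%N -> p`_i = moment Y i / (i`!)%:R by rewrite coef_poly => ->.
have factN0 n : n`!%:R != 0 :> R by rewrite pnatr_eq0 -lt0n fact_gt0.
have qE l : (l < k.+1)%N ->
    joint_cumulant P (fun _ : 'I_l.+1 => Y) = (l.+1`!)%:R * q`_l.+1.
  move=> lk; rewrite joint_cumulantE; apply: diagonal_log => // A.
  have Ak : (#|A| < k.+2)%N.
    by rewrite ltnS (leq_trans (max_card _))// card_ord.
  rewrite pE// mulrCA divff// mulr1 mgf_series_expind.
  by congr (fine (expectation _ _)); apply/funext => w; rewrite prodr_const.
have := deriv_truncated_log p k.+1; rewrite -/q mulrC => /(congr1 (coefp k)).
rewrite /coefp mulrBr mulr1 coefB.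
(* The truncation error is invisible in degree [k]: [1 - p] has no constant term, so its power
   [k.+1] is divisible by ['X^k.+1]. *)
have -> : (p^`() * (1 - p) ^+ k.+1)`_k = 0.
  have /factor_theorem[r ->] : root (1 - p) 0.
    by rewrite /root !hornerE horner_coef0 p0 subrr.
  by rewrite subr0 exprMn mulrA coefMXn ltnSn.
rewrite subr0 coefM coef_deriv => /(congr1 (fun x => (k`!)%:R * x)).
rewrite pE// -mulr_natl factS natrM invfM.
rewrite [X in _ = X](_ : _ = moment Y k.+1); last first.
  by field; rewrite factN0 nat1r pnatr_eq0.
move=> <-; rewrite mulr_sumr; apply: eq_bigr => l _.
have lk : (l <= k)%N by rewrite -ltnS.
rewrite qE// coef_deriv pE ?ltnS ?(leq_trans (leq_subr _ _))//.
rewrite -(bin_fact lk) -mulr_natl factS !natrM.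
by field; rewrite factN0.
Qed.

End moment_cumulant.

(** * Multilinearity of joint cumulants *)

(** In the argument of [G], [None] marks a slot that still holds the whole sum and [Some y] one that
    holds the single summand [y]. Slots are expanded from left to right: slot 0 is the reference
    point and costs [size r], and every later slot costs a factor [K]. *)
Lemma slotwise_sum_bound (R : realType) (I : eqType) (j : nat)
    (G : ('I_j.+1 -> option I) -> R) (r : seq I) (w : I -> I -> R) (C K : R) :
  (forall X i, X i = None ->
    G X = \sum_(y <- r) G (fun k => if k == i then Some y else X k)) ->
  (forall x : 'I_j.+1 -> I, `|G (Some \o x)| <= C * \prod_i w (x ord0) (x i)) ->
  0 <= C -> (forall x y, 0 <= w x y) -> (forall x, w x x <= 1) ->
  (forall x, \sum_(y <- r) w x y <= K) ->
  `|G (fun=> None)| <= C * K ^+ j * (size r)%:R.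
Proof.
move=> Gsum Gbound C0 w0 w1 wK.
(* The first [m] slots are filled and [k] remain to be expanded. *)
have H k m : (m + k = j.+1)%N -> (0 < m)%N -> forall x : 'I_j.+1 -> I,
    `|G (fun i => if (i < m)%N then Some (x i) else None)| <=
    C * (\prod_(i < j.+1 | (i < m)%N) w (x ord0) (x i)) * K ^+ k.
  elim: k m => [|k IH] m mk m0 x.
    rewrite expr0 mulr1; have mE : m = j.+1 by rewrite -mk addn0.
    have := Gbound x.
    rewrite [X in _ <= C * X](eq_bigl (fun i : 'I_j.+1 => (i < m)%N)); last first.
      by move=> i; rewrite mE ltn_ord.
    congr (`|G _| <= _); apply/funext => i /=.
    by rewrite mE ltn_ord.
  have mj : (m < j.+1)%N by rewrite -mk addnS ltnS leq_addr.
  pose im := Ordinal mj.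
  rewrite (Gsum _ im) ?ltnn// (le_trans (ler_norm_sum _ _ _))//.
  have step y : `|G (fun k => if k == im then Some y else
        if (k < m)%N then Some (x k) else None)| <=
      C * (\prod_(i < j.+1 | (i < m)%N) w (x ord0) (x i)) * K ^+ k * w (x ord0) y.
    pose x' i := if i == im then y else x i.
    have x'0 : x' ord0 = x ord0.
      by rewrite /x' -val_eqE /= ltn_eqF.
    have x'm : x' im = y by rewrite /x' eqxx.
    have := IH m.+1 _ isT x'; rewrite addSn -addnS mk => /(_ erefl).
    rewrite x'0 (bigD1 im) ?ltnSn//= x'm.
    rewrite [X in C * (_ * X)](_ : _ =
      \prod_(i < j.+1 | (i < m)%N) w (x ord0) (x i)); last first.
      apply: eq_big => [i|i /andP[_ /negPf]]; last by rewrite /x' => ->.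
      by rewrite -val_eqE /= ltnS ltn_neqAle andbC.
    have -> : (fun i : 'I_j.+1 => if (i < m.+1)%N then Some (x' i) else None) =
        (fun k => if k == im then Some y else if (k < m)%N then Some (x k) else None).
      apply/funext => i; rewrite /x' -val_eqE /= ltnS leq_eqVlt.
      by case: eqP.
    move=> /le_trans; apply; rewrite le_eqVlt; apply/orP; left; apply/eqP.
    by move: (K ^+ k) (w _ y) (\prod_(_ < _ | _) _) => ? ? ?; ring.
  rewrite (le_trans (ler_sum _ (fun y _ => step y)))//.
  rewrite -mulr_sumr exprSr mulrA ler_wpM2l//.
  rewrite !mulr_ge0 ?prodr_ge0 ?exprn_ge0//.
  by rewrite (le_trans _ (wK (x ord0)))// sumr_ge0.
rewrite (Gsum _ ord0)// (le_trans (ler_norm_sum _ _ _))//.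
have -> : C * K ^+ j * (size r)%:R = \sum_(y <- r) C * K ^+ j.
  by rewrite big_const_seq count_predT iter_addr addr0 mulr_natr.
apply: ler_sum => y _.
have := H j 1 (add1n j) isT (fun=> y); rewrite (bigD1 ord0)//= big1 => [|i]; last first.
  by move=> /andP[+ /negP[]]; rewrite ltnS leqn0 -val_eqE.
rewrite mulr1; set g := (fun i => _) => /le_trans H1.
have -> : (fun k : 'I_j.+1 => if k == ord0 then Some y else None) = g.
  by apply/funext => i; rewrite /g ltnS leqn0 -val_eqE.
apply: H1; rewrite mulrAC ler_piMr// mulr_ge0//.
by apply: exprn_ge0; rewrite (le_trans _ (wK y))// sumr_ge0.
Qed.

Section bounded_measurable.
Context {disp : measure_display} {T : measurableType disp} {R : realType}.
Context (P : probability T R).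
Implicit Types f g : T -> R.

(** A class closed under sums and products, on which expectations are finite and linear;
    integrability alone is not preserved by products. *)
Definition bounded_measurable f :=
  measurable_fun setT f /\ exists M, forall w, `|f w| <= M.

Lemma bounded_measurable_cst (c : R) : bounded_measurable (fun=> c).
Proof. by split=> //; exists `|c|. Qed.

Lemma bounded_measurableD f g : bounded_measurable f -> bounded_measurable g ->
  bounded_measurable (fun w => f w + g w).
Proof.
move=> [mf [M fM]] [mg [M' gM]]; split; first exact: measurable_funD.
by exists (M + M') => w; rewrite (le_trans (ler_normD _ _))// lerD.
Qed.

Lemma bounded_measurableM f g : bounded_measurable f -> bounded_measurable g ->
  bounded_measurable (fun w => f w * g w).
Proof.
move=> [mf [M fM]] [mg [M' gM]]; split; first exact: measurable_funM.
by exists (M * M') => w; rewrite normrM ler_pM.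
Qed.

Lemma bounded_measurable_sum (I : Type) (r : seq I) (A : pred I) (F : I -> T -> R) :
  (forall i, bounded_measurable (F i)) ->
  bounded_measurable (fun w => \sum_(i <- r | A i) F i w).
Proof.
move=> bF; elim: r => [|i r IH].
  by under eq_fun do rewrite big_nil; exact: bounded_measurable_cst.
under eq_fun do rewrite big_cons; case: (A i) => //.
exact: bounded_measurableD.
Qed.

Lemma bounded_measurable_prod (I : Type) (r : seq I) (A : pred I) (F : I -> T -> R) :
  (forall i, bounded_measurable (F i)) ->
  bounded_measurable (fun w => \prod_(i <- r | A i) F i w).
Proof.
move=> bF; elim: r => [|i r IH].
  by under eq_fun do rewrite big_nil; exact: bounded_measurable_cst.
under eq_fun do rewrite big_cons; case: (A i) => //.
exact: bounded_measurableM.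
Qed.

Lemma bounded_measurableX f n : bounded_measurable f ->
  bounded_measurable (fun w => f w ^+ n).
Proof.
move=> bf; elim: n => [|n IH].
  by under eq_fun do rewrite expr0; exact: bounded_measurable_cst.
by under eq_fun do rewrite exprS; exact: bounded_measurableM.
Qed.

Lemma bounded_measurable_integrable f : bounded_measurable f ->
  P.-integrable setT (EFin \o f).
Proof.
move=> [mf [M fM]]; apply: measurable_bounded_integrable => //.
  exact: fin_num_fun_lty.
exists M; split; first exact: num_real.
by move=> M' MM' w _ /=; rewrite (le_trans (fM w))// ltW.
Qed.

Lemma expectation_bounded f : bounded_measurable f ->
  ('E_P[f] = (fine 'E_P[f])%:E)%E.
Proof.
move=> bf; rewrite fineK// unlock; apply: integrable_fin_num => //.
exact: bounded_measurable_integrable.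
Qed.

Lemma fine_expectation_lin (a b : R) f g :
  bounded_measurable f -> bounded_measurable g ->
  fine ('E_P[fun w => (a * f w + b * g w)%R])%E =
  a * fine ('E_P[f])%E + b * fine ('E_P[g])%E.
Proof.
move=> bf bg.
have If := bounded_measurable_integrable bf.
have Ig := bounded_measurable_integrable bg.
rewrite unlock integralD_EFin//; last 2 first.
- by apply: (integrableZl measurableT a If).
- by apply: (integrableZl measurableT b Ig).
have scale c u : P.-integrable setT (EFin \o u) ->
    (\int[P]_w (EFin \o (fun w => (c * u w)%R)) w =
     (c * fine (\int[P]_w (u w)%:E))%:E)%E.
  move=> Iu; rewrite EFinM fineK; last exact: integrable_fin_num.
  by rewrite -integralZl.
by rewrite !scale.
Qed.

End bounded_measurable.

Section cumulant_multilinear.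
Context {disp : measure_display} {T : measurableType disp} {R : realType}.
Context (P : probability T R) {j : nat} (X : 'I_j -> T -> R).
Hypothesis bX : forall k, bounded_measurable (X k).

Definition set_slot (i : 'I_j) (f : T -> R) : 'I_j -> T -> R :=
  fun k => if k == i then f else X k.

(** The mixed moments over sets containing [i] are linear in the [i]-th variable and the others do
    not see it. This is [slot_comb], which the logarithm turns into linearity of the top
    coefficient. *)
Lemma joint_cumulant_lin i (a b : R) f g :
  bounded_measurable f -> bounded_measurable g ->
  joint_cumulant P (set_slot i (fun w => a * f w + b * g w)) =
  a * joint_cumulant P (set_slot i f) + b * joint_cumulant P (set_slot i g).
Proof.
move=> bf bg; rewrite !joint_cumulantE; apply: (@slot_comb_log _ _ i).
  rewrite mgf_series_expind; under eq_fun do rewrite big_set0.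
  by rewrite expectation_cst.
move=> A; rewrite !mgf_series_expind; case: ifPn => iA.
  have E u w : \prod_(k in A) set_slot i u k w =
      u w * \prod_(k in A | k != i) X k w.
    rewrite (bigD1 i)//= {1}/set_slot eqxx; congr (_ * _).
    by apply: eq_bigr => k /andP[_ /negPf ki]; rewrite /set_slot ki.
  rewrite -fine_expectation_lin.
  - congr (fine (expectation _ _)); apply/funext => w; rewrite !E; ring.
  - under eq_fun do rewrite E.
    by apply: bounded_measurableM => //; exact: bounded_measurable_prod.
  - under eq_fun do rewrite E.
    by apply: bounded_measurableM => //; exact: bounded_measurable_prod.
have E u w : \prod_(k in A) set_slot i u k w = \prod_(k in A) X k w.
  apply: eq_bigr => k kA; rewrite /set_slot ifN//.
  by apply: contraNneq iA => <-.
by split; congr (fine (expectation _ _)); apply/funext => w; rewrite !E.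
Qed.

Lemma joint_cumulant_sum (I : Type) (r : seq I) (Y : I -> T -> R) i :
  (forall y, bounded_measurable (Y y)) ->
  joint_cumulant P (set_slot i (fun w => \sum_(y <- r) Y y w)) =
  \sum_(y <- r) joint_cumulant P (set_slot i (Y y)).
Proof.
move=> bY; elim: r => [|y r IH].
  have := joint_cumulant_lin i 0 0 (bX i) (bX i).
  rewrite !mul0r addr0 big_nil; apply: etrans; congr (joint_cumulant _ (set_slot _ _)).
  by apply/funext => w; rewrite big_nil !mul0r addr0.
rewrite big_cons -IH.
have := joint_cumulant_lin i 1 1 (bY y) (bounded_measurable_sum r xpredT bY).
rewrite !mul1r => <-; congr (joint_cumulant _ (set_slot _ _)).
by apply/funext => w; rewrite big_cons !mul1r.
Qed.

End cumulant_multilinear.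

Lemma cumulant_sum_bound (disp : measure_display) (T : measurableType disp)
    (R : realType) (P : probability T R) (I : eqType) (r : seq I)
    (Y : I -> T -> R) (j : nat) (w : I -> I -> R) (C K : R) :
  (forall y, bounded_measurable (Y y)) ->
  (forall x : 'I_j.+1 -> I,
    `|joint_cumulant P (fun k => Y (x k))| <= C * \prod_i w (x ord0) (x i)) ->
  0 <= C -> (forall x y, 0 <= w x y) -> (forall x, w x x <= 1) ->
  (forall x, \sum_(y <- r) w x y <= K) ->
  `|joint_cumulant P (fun _ : 'I_j.+1 => fun t => \sum_(y <- r) Y y t)| <=
  C * K ^+ j * (size r)%:R.
Proof.
move=> bY bound C0 w0 w1 wK.
pose S t := \sum_(y <- r) Y y t.
pose slot (o : option I) := if o is Some y then Y y else S.
have bslot o : bounded_measurable (slot o).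
  by case: o => [y|]//=; exact: bounded_measurable_sum.
apply: (@slotwise_sum_bound R I j (fun X => joint_cumulant P (slot \o X)) r w C K)
  => // X i Xi.
have := joint_cumulant_sum P (fun k => bslot (X k)) r i bY.
rewrite -/S [X in joint_cumulant P X](_ : _ = slot \o X); last first.
  by apply/funext => k; rewrite /set_slot; case: eqP => [->|//]; rewrite /= Xi.
move=> ->; apply: eq_bigr => y _; congr joint_cumulant; apply/funext => k /=.
by rewrite /set_slot; case: eqP.
Qed.

(** * Centred moments *)

Lemma triangular_sum (R : zmodType) (F : nat -> nat -> R) (n : nat) :
  \sum_(i < n) \sum_(l < i.+1) F i l = \sum_(l < n) \sum_(i < n - l) F (l + i)%N l.
Proof.
elim: n => [|n IH]; first by rewrite !big_ord0.
rewrite big_ord_recr /= IH.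
transitivity (\sum_(l < n.+1) (\sum_(i < n - l) F (l + i)%N l + F n l)).
  by rewrite big_split/= [in RHS]big_ord_recr/= subnn big_ord0 addr0.
apply: eq_bigr => l _; have ln : (l <= n)%N by rewrite -ltnS.
by rewrite subSn// big_ord_recr/= subnKC.
Qed.

Lemma bin_revision (k i l : nat) : (l + i <= k)%N ->
  ('C(k, l + i) * 'C(l + i, l) = 'C(k, l) * 'C(k - l, i))%N.
Proof.
move=> lik; have lk : (l <= k)%N by rewrite (leq_trans _ lik)// leq_addr.
have ikl : (i <= k - l)%N by rewrite leq_subRL.
have := bin_fact lik; have := bin_fact (leq_addr i l).
have := bin_fact lk; have := bin_fact ikl; rewrite addKn subnDA.
move=> <- <- <- E.
have : (0 < l`! * i`! * (k - l - i)`!)%N by rewrite !muln_gt0 !fact_gt0.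
move=> /eqn_pmul2r Ep; apply/eqP; rewrite -Ep; apply/eqP; nia.
Qed.

Section centered_moments.
Context {disp : measure_display} {T : measurableType disp} {R : realType}.
Context (P : probability T R) (S : T -> R).
Hypothesis bS : bounded_measurable S.

Lemma fine_expectation_sum (I : Type) (r : seq I) (a : I -> R) (f : I -> T -> R) :
  (forall i, bounded_measurable (f i)) ->
  fine ('E_P[fun w => (\sum_(i <- r) a i * f i w)%R])%E =
  \sum_(i <- r) a i * fine ('E_P[f i])%E.
Proof.
move=> bf; elim: r => [|i r IH].
  by under eq_fun do rewrite big_nil; rewrite expectation_cst big_nil.
rewrite big_cons -IH -[X in _ + X]mul1r -fine_expectation_lin//.
  by congr (fine (expectation _ _)); apply/funext => w; rewrite big_cons mul1r.
apply: bounded_measurable_sum => k.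
exact: bounded_measurableM (bounded_measurable_cst _) (bf k).
Qed.

Lemma expectation_centered_pow (c : R) (e k : nat) :
  fine ('E_P[fun w => (S w ^+ e * (S w - c) ^+ k)%R])%E =
  \sum_(i < k.+1) 'C(k, i)%:R * (- c) ^+ (k - i) * moment P S (e + i).
Proof.
rewrite -(fine_expectation_sum _ (fun i : 'I_k.+1 => 'C(k, i)%:R * (- c) ^+ (k - i))
   (f := fun i : 'I_k.+1 => fun w => S w ^+ (e + i))); last first.
  by move=> i; exact: bounded_measurableX.
congr (fine (expectation _ _)); apply/funext => w.
rewrite [S w - c]addrC exprDn mulr_sumr; apply: eq_bigr => i _.
by rewrite exprD -mulr_natl; ring.
Qed.

(* The recursion between moments and cumulants extends from [E(S * S^k)] to
   [E(S * q(S))] for every polynomial [q]; here [q(S) = (S - c)^k]. *)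
Lemma centered_moment_cumulant (c : R) (k : nat) :
  fine ('E_P[fun w => (S w * (S w - c) ^+ k)%R])%E =
  \sum_(l < k.+1) 'C(k, l)%:R * joint_cumulant P (fun _ : 'I_l.+1 => S)
     * moment P (fun w => S w - c) (k - l).
Proof.
have := expectation_centered_pow c 1 k; under eq_fun do rewrite expr1; move=> ->.
transitivity (\sum_(i < k.+1) \sum_(l < i.+1) 'C(k, i)%:R * (- c) ^+ (k - i) *
    ('C(i, l)%:R * joint_cumulant P (fun _ : 'I_l.+1 => S) * moment P S (i - l))).
  by apply: eq_bigr => i _; rewrite add1n moment_cumulant mulr_sumr.
rewrite (triangular_sum (fun i l => 'C(k, i)%:R * (- c) ^+ (k - i) *
    ('C(i, l)%:R * joint_cumulant P (fun _ : 'I_l.+1 => S) * moment P S (i - l)))).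
apply: eq_bigr => l _; have lk : (l <= k)%N by rewrite -ltnS.
have := expectation_centered_pow c 0 (k - l).
under eq_fun do rewrite expr0 mul1r.
rewrite -/(moment P (fun w => S w - c) (k - l)) => ->.
rewrite mulr_sumr subSn//; apply: eq_bigr => i _.
have ikl : (i <= k - l)%N by rewrite -ltnS.
have lik : (l + i <= k)%N by rewrite -leq_subRL.
rewrite add0n addKn subnDA.
have := bin_revision lik => /(congr1 (fun n => n%:R : R)); rewrite !natrM => E.
transitivity ('C(k, l + i)%:R * 'C(l + i, l)%:R * ((- c) ^+ (k - l - i) *
  joint_cumulant P (fun _ : 'I_l.+1 => S) * moment P S i)); first by ring.
by rewrite E; ring.
Qed.

Lemma moment0 (Y : T -> R) : moment P Y 0 = 1.
Proof.
by rewrite /moment; under eq_fun do rewrite expr0; rewrite expectation_cst.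
Qed.

Definition standardized (c s : R) (w : T) : R := (S w - c) / s.

(** Centring removes the term [l = 0]: it carries the first cumulant [c], and so equals the
    difference between [E (S (S - c)^k)] and [E ((S - c)^(k+1))]. *)
Lemma standardized_recursion (s : R) (k : nat) (c := moment P S 1) : s != 0 ->
  moment P (standardized c s) k.+1 =
  \sum_(1 <= l < k.+1) 'C(k, l)%:R *
    (joint_cumulant P (fun _ : 'I_l.+1 => S) / s ^+ l.+1)
     * moment P (standardized c s) (k - l).
Proof.
move=> s0.
have zE i : moment P (standardized c s) i = s ^- i * moment P (fun w => S w - c) i.
  rewrite /moment -[RHS]addr0 -[X in _ + X](mul0r (fine 'E_P[fun=> 1])).
  rewrite -fine_expectation_lin.
  - congr (fine (expectation _ _)); apply/funext => w.
    by rewrite /standardized expr_div_n mul0r addr0 mulrC.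
  - apply: bounded_measurableX; apply: bounded_measurableD => //.
    exact: bounded_measurable_cst.
  - exact: bounded_measurable_cst.
have bSc i : bounded_measurable (fun w => (S w - c) ^+ i).
  apply: bounded_measurableX; apply: bounded_measurableD => //.
  exact: bounded_measurable_cst.
have k1 : joint_cumulant P (fun _ : 'I_1 => S) = c.
  have := moment_cumulant P S 0; rewrite big_ord_recl big_ord0 addr0 bin0 mul1r.
  by rewrite moment0 mulr1 => <-.
have := centered_moment_cumulant c k.
have -> : fine ('E_P[fun w => (S w * (S w - c) ^+ k)%R])%E =
    moment P (fun w => S w - c) k.+1 + c * moment P (fun w => S w - c) k.
  rewrite -[X in _ = X + _]mul1r -fine_expectation_lin//.
  by congr (fine (expectation _ _)); apply/funext => w; rewrite exprS; ring.
rewrite big_ord_recl bin0 mul1r k1 subn0 addrC => /addrI E.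
rewrite zE E mulr_sumr big_add1 big_mkord /=; apply: eq_bigr => l _.
have lk : (l.+1 <= k)%N by [].
rewrite zE /bump /= add1n.
have -> : s ^- k.+1 = s ^- l.+2 * s ^- (k - l.+1).
  by rewrite -invfM -exprD; congr (_ ^- _); lia.
by ring.
Qed.

End centered_moments.

(** [rho] stands for [v^(-1/2)]. Both parities are carried through one induction, as the step to
    even order uses the bound on odd moments. *)
Lemma gaussian_moment_comparison (R : realType) (g C : nat -> R) :
  g 0 = 1 -> g 1 = 0 -> (forall k, g k.+2 = k.+1%:R * g k) ->
  forall n, exists D : R, forall (rho : R) (z lam : nat -> R),
    0 <= rho <= 1 -> z 0 = 1 -> z 1 = 0 -> lam 2 = 1 ->
    (forall j, (3 <= j)%N -> `|lam j| <= C j * rho ^+ (j - 2)) ->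
    (forall k, z k.+1 = \sum_(1 <= l < k.+1) 'C(k, l)%:R * lam l.+1 * z (k - l)%N) ->
    forall k, (k <= n)%N -> `|z k - g k| <= D * rho ^+ (if odd k then 1 else 2).
Proof.
move=> g0 g1 gS.
have godd k : odd k -> g k = 0.
  elim/ltn_ind: k => -[|[|k]] IH //=; rewrite negbK => ok.
  by rewrite gS IH ?mulr0.
elim=> [|n [D HD]].
  exists 0 => rho z lam _ z0 _ _ _ _ k; rewrite leqn0 => /eqP ->.
  by rewrite z0 g0 subrr normr0 mul0r.
pose D0 := `|D|; have D00 : 0 <= D0 := normr_ge0 D.
pose B := \sum_(2 <= l < n.+1) 'C(n, l)%:R * `|C l.+1| * (`|g (n - l)%N| + D0).
have B0 : 0 <= B by apply: sumr_ge0 => l _; rewrite !mulr_ge0// addr_ge0.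
exists (n%:R * D0 + B + D0) => rho z lam rho01 z0 z1 lam2 Hlam Hz.
have /andP[rho0 rho1] := rho01.
have {}HD k : (k <= n)%N -> `|z k - g k| <= D0 * rho ^+ (if odd k then 1 else 2).
  move=> /(HD _ _ _ rho01 z0 z1 lam2 Hlam Hz)/le_trans; apply.
  by rewrite ler_wpM2r ?exprn_ge0// ler_norm.
move=> k; rewrite leq_eqVlt => /predU1P[->|/HD]; last first.
  move=> /le_trans; apply; rewrite ler_wpM2r ?exprn_ge0// lerDr.
  by rewrite addr_ge0// mulr_ge0.
move: @D0 @B D00 B0 HD; set D0 := `|D|; move: D0 => D0 /= D00.
case: n {k} => [|n] /=; set B := \sum_(2 <= l < _) _ => B0 HD.
  rewrite z1 g1 subrr normr0 mulr_ge0 ?exprn_ge0//.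
  by rewrite !addr_ge0// mulr_ge0.
(* Since [lam 2 = 1], the term [l = 1] is the Gaussian recursion applied to [z]; it leaves a
   multiple of an earlier error of the same parity. *)
rewrite Hz gS big_ltn// bin1 lam2 mulr1 subn1 /= -addrAC -mulrBr.
rewrite (le_trans (ler_normD _ _))//.
rewrite mulrDl ler_wpDr ?mulr_ge0 ?exprn_ge0//.
rewrite mulrDl lerD//.
  rewrite normrM normr_nat -mulrA ler_wpM2l//.
  by rewrite negbK; exact: HD.
rewrite (le_trans (ler_norm_sum _ _ _))// /B mulr_suml.
apply: ler_sum_nat => l /andP[l2 ln].
rewrite !normrM normr_nat -!mulrA ler_wpM2l//.
(* Odd moments are themselves of order [rho], because those of [g] vanish; even ones are merely
   bounded. *)
have zb : `|z (n.+1 - l)%N| <= (`|g (n.+1 - l)%N| + D0) * rho ^+ (odd (n.+1 - l)).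
  rewrite -[z _](subrK (g (n.+1 - l)%N)) addrC (le_trans (ler_normD _ _))//.
  rewrite mulrDl lerD//.
    case: (boolP (odd _)) => [/godd ->|_]; first by rewrite normr0 mul0r.
    by rewrite mulr1.
  rewrite (le_trans (HD _ (leq_subr _ _)))// ler_wpM2l//.
  by apply: ler_wiXn2l => //; case: (odd _).
rewrite (le_trans (ler_pM _ _ (Hlam l.+1 _) zb))//.
rewrite mulrACA -exprD [leRHS]mulrA.
apply: (@le_trans _ _ (`|C l.+1| * (`|g (n.+1 - l)%N| + D0) *
    rho ^+ (l.+1 - 2 + odd (n.+1 - l)))).
  by rewrite !ler_wpM2r ?exprn_ge0 ?addr_ge0// ler_norm.
rewrite ler_wpM2l ?mulr_ge0 ?addr_ge0//; apply: ler_wiXn2l => //.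
(* For [l >= 3] the cumulant alone gives [rho ^+ 2]. For [l = 2] it gives only [rho]; if [n.+2] is
   even, the accompanying moment has odd order and supplies the second factor. *)
rewrite negbK oddB; last by rewrite -ltnS.
by case: l l2 ln {zb} => [|[|[|l]]]//= _ _; case: (odd n) => //=; lia.
Qed.

(** * Trees and sums over the lattice *)

Section lattice_distance.
Context {d : nat}.
Implicit Types (x y z : lattice d).

Definition dist x y : nat := (\sum_(k < d) `|x k - y k|)%N.

Lemma l1distE x y : l1dist x y = (dist x y)%:Z.
Proof. by rewrite /l1dist /dist (big_morph Posz PoszD erefl). Qed.

Lemma dist_sym x y : dist x y = dist y x.
Proof. by apply: eq_bigr => k _; rewrite distnC. Qed.

Lemma dist_triangle x y z : (dist x z <= dist x y + dist y z)%N.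
Proof.
by rewrite -big_split leq_sum// => k _; rewrite leqD_dist.
Qed.

Lemma dist_eq0 x y : (dist x y == 0)%N = (x == y).
Proof.
apply/eqP/eqP => [/eqP|->]; last by rewrite /dist big1// => k _; rewrite subrr.
rewrite sum_nat_eq0 => /forallP/= xy; apply/ffunP => k.
by have := xy k; rewrite absz_eq0 subr_eq0 => /eqP.
Qed.

Lemma distxx x : dist x x = 0%N. Proof. by apply/eqP; rewrite dist_eq0. Qed.

Lemma dist_step x y : x != y -> exists z, dist y z = 1%N /\ dist x y = (dist x z).+1.
Proof.
move=> xy; have [k xyk] : exists k, x k != y k.
  apply/existsP; apply: contraNT xy; rewrite negb_exists => /forallP xy.
  by apply/eqP/ffunP => k; apply/eqP; have := xy k; rewrite negbK.
pose s : int := if (x k < y k)%R then -1 else 1.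
exists [ffun i => if i == k then y k + s else y i]; split.
  rewrite /dist (bigD1 k)//= ffunE eqxx big1 ?addn0; last first.
    by move=> i /negPf ik; rewrite ffunE ik subrr.
  by rewrite /s; case: ifP; lia.
rewrite /dist (bigD1 k)//= [in RHS](bigD1 k)//= ffunE eqxx -addSn; congr (_ + _)%N.
  by rewrite /s; case: ifP; lia.
by apply: eq_bigr => i /negPf ik; rewrite ffunE ik.
Qed.

End lattice_distance.

Section trees.
Context {d : nat}.
Implicit Types (x y : lattice d) (V : {fset lattice d}) (E : {fset {fset lattice d}}).

Lemma bond_adj_sym E : symmetric (bond_adj E).
Proof. by move=> x y; rewrite /bond_adj fsetUC. Qed.

Lemma fset2_eq (T : choiceType) (a b u v : T) : [fset a; b]%fset = [fset u; v]%fset ->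
  (a = u /\ b = v) \/ (a = v /\ b = u).
Proof.
move=> /fsetP E.
have /orP[/eqP|/eqP] : (a == u) || (a == v) by have := E a; rewrite !inE eqxx.
all: have /orP[/eqP|/eqP] : (b == u) || (b == v)
  by have := E b; rewrite !inE eqxx orbT.
all: have /orP[/eqP|/eqP] : (u == a) || (u == b) by have := E u; rewrite !inE eqxx.
all: have /orP[/eqP|/eqP] : (v == a) || (v == b)
  by have := E v; rewrite !inE eqxx orbT.
all: by move=> *; subst; auto.
Qed.

Lemma path_dist_le E x p :
  (forall u v, bond_adj E u v -> dist u v = 1%N) ->
  path (bond_adj E) x p -> (dist x (last x p) <= size p)%N.
Proof.
move=> E1; elim: p x => [|y p IH] x /=; first by rewrite distxx.
move=> /andP[/E1 xy /IH yp]; rewrite (leq_trans (dist_triangle _ y _))//.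
by rewrite xy add1n ltnS.
Qed.

(* The bonds of a self-avoiding path are pairwise distinct. *)
Lemma uniq_path_bonds E x p : path (bond_adj E) x p -> uniq (x :: p) ->
  (size p <= #|`E|)%N.
Proof.
pose b (u v : lattice d) := [fset u; v]%fset.
have memb q u e : e \in pairmap b u q -> forall v, v \in e -> v \in u :: q.
  elim: q u => [//|y q IH] u /=; rewrite in_cons => /orP[/eqP ->|/IH h] v.
    by rewrite !inE => /orP[->//|->]; rewrite orbT.
  by move=> /h; rewrite [v \in [:: u, y & q]]in_cons => ->; rewrite orbT.
have uniqb q u : uniq (u :: q) -> uniq (pairmap b u q).
  elim: q u => [//|y q IH] u /= /andP[uq /andP[yq uniqq]].
  rewrite IH/= ?yq ?uniqq// andbT; apply: contra uq => /memb; apply.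
  by rewrite !inE eqxx.
have allE q u : path (bond_adj E) u q -> {subset pairmap b u q <= E}.
  elim: q u => [//|y q IH] u /= /andP[uy /IH h] e.
  by rewrite in_cons => /orP[/eqP ->//|/h].
move=> xp /uniqb up; rewrite -(size_pairmap b x p).
exact: uniq_leq_size up (allE _ _ xp).
Qed.

(** A path joining the two points can be made self-avoiding; it then uses distinct bonds, and each
    bond advances by distance one. *)
Lemma tree_dist_le V E x y : is_tree V E -> x \in V -> y \in V ->
  (dist x y <= #|`E|)%N.
Proof.
move=> [_ nnE conn _] xV yV; have [p xp <-] := conn _ _ xV yV.
case: (shortenP xp) => q xq uq _.
rewrite (leq_trans _ (uniq_path_bonds xq uq))//; apply: path_dist_le xq.
move=> u v /nnE[a [c [_ _]]]; rewrite l1distE => -[ac] /fset2_eq[] [-> ->]//.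
by rewrite dist_sym.
Qed.

Lemma tree_point x : is_tree [fset x]%fset fset0.
Proof.
split.
- by apply/fset0Pn; exists x; rewrite inE.
- by move=> e; rewrite inE.
- by move=> u v; rewrite !inE => /eqP -> /eqP ->; exists [::].
- by move=> [|u [|v p]]//=; rewrite /bond_adj inE.
Qed.

(** The new vertex [z] has [v] as its only neighbour. In a cycle through [z], both the successor and
    the predecessor of [z] are thus [v], and a cycle without repetition has size at most 2. *)
Lemma tree_leaf V E v z : is_tree V E -> v \in V -> z \notin V -> dist v z = 1%N ->
  is_tree (z |` V)%fset ([fset v; z] |` E)%fset.
Proof.
move=> [V0 nnE conn acyc] vV zV vz.
have sub u w : bond_adj E u w -> bond_adj ([fset v; z] |` E)%fset u w.
  by rewrite /bond_adj => uw; rewrite in_fset1U uw orbT.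
have adjV u w : bond_adj E u w -> u \in V /\ w \in V.
  by move=> /nnE[a [c [aV cV _ /fset2_eq[] [-> ->]]]].
have vzE : bond_adj ([fset v; z] |` E)%fset v z.
  by rewrite /bond_adj in_fset1U eqxx.
have new u w : bond_adj ([fset v; z] |` E)%fset u w ->
    bond_adj E u w \/ (u = v /\ w = z) \/ (u = z /\ w = v).
  by rewrite {1}/bond_adj in_fset1U => /orP[/eqP/fset2_eq|]; auto.
split.
- by apply/fset0Pn; exists z; rewrite !inE eqxx.
- move=> e; rewrite in_fset1U => /orP[/eqP ->|/nnE[a [c [aV cV ac ->]]]].
    by exists v, z; rewrite !inE vV eqxx orbT l1distE vz.
  by exists a, c; rewrite !inE aV cV !orbT.
- have toz u : u \in V ->
      exists2 p, path (bond_adj ([fset v; z] |` E)%fset) u p & last u p = z.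
    move=> uV; have [p up pv] := conn _ _ uV vV; exists (rcons p z).
      by rewrite rcons_path (sub_path sub up) pv.
    by rewrite last_rcons.
  have fromz u : u \in V ->
      exists2 p, path (bond_adj ([fset v; z] |` E)%fset) z p & last z p = u.
    move=> uV; have [p up pv] := conn _ _ vV uV; exists (v :: p) => //=.
    by rewrite (sub_path sub up) bond_adj_sym vzE.
  move=> x y; rewrite !in_fset1U => /orP[/eqP ->|xV] /orP[/eqP ->|yV].
  + by exists [::].
  + exact: fromz.
  + exact: toz.
  + by have [p xp py] := conn _ _ xV yV; exists p => //; exact: sub_path xp.
- move=> p cp up; have [zp|zp] := boolP (z \in p); last first.
    apply: acyc => //; apply: (sub_in_cycle (P := mem p) _ _ cp); last exact/allP.
  move=> u w up' wp /new[//|[] [uE wE]]; first by rewrite -wE wp in zp.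
  by rewrite -uE up' in zp.
  have zadj w : bond_adj ([fset v; z] |` E)%fset z w -> w = v.
    move=> /new[/adjV[zV' _]|[] [zE wE]//]; first by rewrite zV' in zV.
    by rewrite wE zE.
  move: (rot_to zp) => [i q rq].
  have {cp} : cycle (bond_adj ([fset v; z] |` E)%fset) (z :: q) by rewrite -rq rot_cycle.
  have {up} : uniq (z :: q) by rewrite -rq rot_uniq.
  rewrite -(size_rot i p) rq.
  case: q rq => [//|u q] _; case: (lastP q) => [//|q' t] /=.
  move=> /and3P[_ uq _] /andP[/zadj uE]; rewrite rcons_path => /andP[_].
  rewrite last_rcons bond_adj_sym => /zadj tE.
  by move: uq; rewrite uE tE mem_rcons inE eqxx.
Qed.

(** Induction on the distance of [y] to a fixed vertex [x] of the tree: a neighbour of [y] closer to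
    [x] is reached first, and [y] is attached to it as a leaf. *)
Lemma tree_extend V E y : is_tree V E ->
  exists V' E', [/\ is_tree V' E', (V `<=` V')%fset & y \in V'].
Proof.
move=> tVE; have [/fset0Pn[x xV] _ _ _] := tVE.
elim: {y}(dist x y) {-2}y (erefl (dist x y)) => [|n IH] y xyn.
  exists V, E; split=> //; move/eqP: xyn; rewrite dist_eq0 => /eqP <- //.
have xy : x != y by rewrite -dist_eq0 xyn.
have [z [yz]] := dist_step xy; rewrite xyn => -[/esym xzn].
have [V' [E' [tVE' VV' zV']]] := IH z xzn.
have [yV'|yV'] := boolP (y \in V'); first by exists V', E'.
exists (y |` V')%fset, ([fset z; y] |` E')%fset; split.
- by apply: tree_leaf => //; rewrite dist_sym.
- by apply: fsubset_trans VV' _; exact: fsubsetU1.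
- by rewrite !inE eqxx.
Qed.

Lemma tree_containing (A : {fset lattice d}) : A != fset0 ->
  exists V E, is_tree V E /\ (A `<=` V)%fset.
Proof.
move=> /fset0Pn[x xA].
have [V [E [tVE sV]]] : exists V E, is_tree V E /\ {subset enum_fset A <= V}.
  elim: (enum_fset A) => [|y s [V [E [tVE sV]]]].
    by exists [fset x]%fset, fset0; split=> //; exact: tree_point.
  have [V' [E' [tVE' VV' yV']]] := tree_extend y tVE.
  exists V', E'; split=> // u; rewrite in_cons => /orP[/eqP ->//|/sV uV].
  exact: (fsubsetP VV').
by exists V, E; split=> //; apply/fsubsetP => u; exact: sV.
Qed.

(** The definition of [tree_length] falls back on the value 0 when there is no minimum. Existence of
    a tree containing [A] excludes this, and a lower bound on every tree becomes one on
    [tree_length A]. *)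
Lemma tree_length_attained (A : {fset lattice d}) : A != fset0 ->
  exists V E, [/\ is_tree V E, (A `<=` V)%fset & #|`E|%fset = tree_length A].
Proof.
move=> /tree_containing[V [E [tVE AV]]].
pose Q m := `[< exists V E, [/\ is_tree V E, (A `<=` V)%fset & #|`E|%fset = m] >].
have exQ : exists m, Q m by exists #|`E|%fset; apply/asboolP; exists V, E.
have [m /asboolP Qm mQ] := ex_minnP exQ.
rewrite /tree_length; case: xgetP => [l _ [//]|/(_ m)[]].
by split=> // V' E' tVE' AV'; apply: mQ; apply/asboolP; exists V', E'.
Qed.

Lemma tree_length_ge_dist (A : {fset lattice d}) x y : x \in A -> y \in A ->
  (dist x y <= tree_length A)%N.
Proof.
move=> xA yA; have A0 : A != fset0 by apply/fset0Pn; exists x.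
have [V [E [tVE /fsubsetP AV <-]]] := tree_length_attained A0.
by apply: tree_dist_le tVE _ _; exact: AV.
Qed.

(** The tree length dominates each of the [j.+1] distances to [x ord0]. Sharing out [q ^+ j.+1], one
    factor [q] to each point, gives a product that can be summed over the points one at a time. *)
Lemma exp_tree_length_le (R : realType) (j : nat) (x : 'I_j.+1 -> lattice d)
    (eps q : R) : 0 <= eps -> 0 <= q <= 1 -> eps <= q ^+ j.+1 ->
  eps ^+ tree_length [fset x k | k in 'I_j.+1]%fset <=
  \prod_i q ^+ dist (x ord0) (x i).
Proof.
move=> eps0 /andP[q0 q1] epsq; set A := [fset x k | k in 'I_j.+1]%fset.
have xA i : x i \in A by apply/imfsetP; exists i.
rewrite prodrXr.
apply: (@le_trans _ _ ((q ^+ j.+1) ^+ tree_length A)).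
  by rewrite lerXn2r// nnegrE exprn_ge0.
rewrite -exprM ler_wiXn2l//.
have -> : (j.+1 * tree_length A = \sum_(i < j.+1) tree_length A)%N.
  by rewrite sum_nat_const card_ord.
by apply: leq_sum => i _; exact: tree_length_ge_dist.
Qed.

End trees.

(** Bernoulli's inequality, proved as [H], provides an explicit [q] and avoids extracting a root of
    [eps]. *)
Lemma root_bound (R : realType) (eps : R) (j : nat) : 0 < eps < 1 ->
  exists2 q : R, 0 <= q < 1 & eps <= q ^+ j.+1.
Proof.
move=> /andP[eps0 eps1]; exists (1 - (1 - eps) / j.+1%:R).
  have j0 : 0 < j.+1%:R :> R by rewrite ltr0n.
  rewrite subr_ge0 ler_pdivrMr// mul1r gtrBl divr_gt0 ?subr_gt0// andbT.
  by rewrite (@le_trans _ _ 1)// ?ler1n// gerBl ltW.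
have H n (u : R) : 0 <= u <= 1 -> 1 - u *+ n <= (1 - u) ^+ n.
  move=> /andP[u0 u1]; elim: n => [|n IH]; first by rewrite mulr0n subr0 expr0.
  rewrite exprS; have := mulrn_wge0 n u0 => un.
  apply: (@le_trans _ _ ((1 - u) * (1 - u *+ n))).
    by rewrite mulrS mulrBl mul1r mulrBr mulr1; nra.
  by rewrite ler_wpM2l// subr_ge0.
rewrite (le_trans _ (H _ _ _))//; last first.
  rewrite divr_ge0 ?subr_ge0 ?(ltW eps1)//= ler_pdivrMr ?ltr0n// mul1r.
  by rewrite (@le_trans _ _ 1)// ?ler1n// gerBl ltW.
by rewrite -[_ *+ _]mulr_natr divfK ?pnatr_eq0// opprB addrC subrK.
Qed.

Section box_sums.
Context {d : nat}.

(** Points of the box are indexed by functions into an ordinal, so that sums of products over the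
    box factor into sums over the coordinates. *)
Definition box_point n (s : {ffun 'I_d -> 'I_(2 * n + 1)}) : lattice d :=
  [ffun k => (s k : nat)%:Z - n%:Z].

Definition box_seq n : seq (lattice d) :=
  [seq box_point s | s <- enum {: {ffun 'I_d -> 'I_(2 * n + 1)}}].

Lemma box_point_inj n : injective (@box_point n).
Proof.
move=> s t /ffunP st; apply/ffunP => k; apply/val_inj => /=.
by have := st k; rewrite !ffunE; lia.
Qed.

Lemma uniq_box_seq n : uniq (box_seq n).
Proof. by rewrite map_inj_uniq ?enum_uniq//; exact: box_point_inj. Qed.

Lemma size_box_seq n : size (box_seq n) = ((2 * n + 1) ^ d)%N.
Proof. by rewrite size_map -cardE card_ffun !card_ord. Qed.

Lemma mem_box_seq n (x : lattice d) : x \in box_seq n <-> box n x.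
Proof.
split=> [/mapP[s _ ->] k|xn]; first by rewrite ffunE; case: (s k) => m /=; lia.
have xs k : (`|(x k + n%:Z)%R| < 2 * n + 1)%N by move: (x k : int) (xn k : `|x k : int| <= n%:Z) => u; lia.
apply/mapP; exists [ffun k => Ordinal (xs k)]; first by rewrite mem_enum.
by apply/ffunP => k; rewrite !ffunE /=; move: (x k : int) (xn k : `|x k : int| <= n%:Z) => u; lia.
Qed.

Lemma magnetizationE (R : realType) n (w : config d) :
  magnetization n w = \sum_(x <- box_seq n) spin R (w x).
Proof.
rewrite /magnetization (fsbigE (box_seq n)).
- rewrite big_mkcond/=; apply: eq_big_seq => x /mem_box_seq xn.
  by rewrite mem_set.
- exact: uniq_box_seq.
- by move=> x /= /mem_box_seq.
- by move=> x /mem_box_seq ->.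
Qed.

(* The sum telescopes: [q ^+ `|m|] is the increment at [m] of the bounded
   sequence [phi]. *)
Lemma geometric_line_sum (R : realType) (q : R) (a : int) (N : nat) :
  0 <= q < 1 -> \sum_(i < N) q ^+ `|(a - i%:Z)%R|%N <= 2 / (1 - q).
Proof.
move=> /andP[q0 q1]; have q10 : 0 < 1 - q by rewrite subr_gt0.
pose phi (m : int) := match m with
  | Posz n => (1 - q ^+ n) / (1 - q) | Negz n => - (q * (1 - q ^+ n.+1) / (1 - q)) end.
have phiS m : phi (m + 1) - phi m = q ^+ `|m|%N.
  case: m => [n|[|n]].
  - rewrite -PoszD addn1 /= -mulrBl exprS.
    by apply: (mulIf (lt0r_neq0 q10)); rewrite divfK ?lt0r_neq0//; ring.
  - by rewrite /= expr0 subrr mul0r sub0r opprK expr1 mulfK ?lt0r_neq0.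
  - have -> : Negz n.+1 + 1 = Negz n by lia.
    by rewrite /= !exprS; field; exact: lt0r_neq0.
have qn n : 0 <= q ^+ n <= 1 by rewrite exprn_ge0//= exprn_ile1// ltW.
have phib m : `|phi m| <= 1 / (1 - q).
  case: m => n /=; rewrite ?normrN normrM normfV (gtr0_norm q10).
    rewrite ler_pM2r ?invr_gt0//; have /andP[? ?] := qn n.
    by rewrite ger0_norm ?subr_ge0// gerBl.
  rewrite ler_pM2r ?invr_gt0//; have /andP[? ?] := qn n.+1.
  rewrite ger0_norm ?mulr_ge0 ?subr_ge0//; nra.
have -> : \sum_(i < N) q ^+ `|(a - i%:Z)%R|%N = phi (N%:Z - a) - phi (- a).
  elim: N => [|N IH].
    by rewrite big_ord0 (_ : 0%:Z - a = - a) ?subrr//; lia.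
  rewrite big_ord_recr/= IH distnC -phiS.
  rewrite (_ : N%:Z - a + 1 = N.+1%:Z - a); last by lia.
  by ring.
rewrite (le_trans (ler_norm _))// (le_trans (ler_normB _ _))//.
by rewrite [2]/(1 + 1) mulrDl lerD.
Qed.

Lemma geometric_box_sum (R : realType) (q : R) n (x : lattice d) : 0 <= q < 1 ->
  \sum_(y <- box_seq n) q ^+ dist x y <= (2 / (1 - q)) ^+ d.
Proof.
move=> q01; rewrite big_map big_enum /=.
pose F k (i : 'I_(2 * n + 1)) := q ^+ `|(x k + n%:Z - (i : nat)%:Z)%R|%N.
rewrite (eq_bigr (fun s : {ffun 'I_d -> 'I_(2 * n + 1)} => \prod_k F k (s k))).
  rewrite -(bigA_distr_bigA F) -[d in _ ^+ d]card_ord -prodr_const.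
  have /andP[q0 q1] := q01.
  apply: ler_prod => k _; rewrite sumr_ge0/=; last by move=> i _; exact: exprn_ge0.
  exact: geometric_line_sum.
move=> s _; rewrite /dist -prodrXr; apply: eq_bigr => k _.
by rewrite /F ffunE; congr (_ ^+ absz _); lia.
Qed.

End box_sums.

(** * Moments of the normal distribution *)

Section normal_moments.
Context {R : realType}.
Notation mu := (@lebesgue_measure R).
Notation phi := (@normal_pdf R 0 1).

Fixpoint normal_moment (k : nat) : R :=
  match k with 0%N => 1 | 1%N => 0 | k.+2 => k.+1%:R * normal_moment k end.

Lemma normal_pdf01E x : phi x = normal_peak 1 * expR (- x ^+ 2 / 2).
Proof.
by rewrite normal_pdfE ?oner_eq0// /normal_fun subr0 expr1n.
Qed.

Lemma is_derive_power_pdf (k : nat) (x : R) :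
  is_derive x 1 (fun y => y ^+ k.+1 * phi y) (k.+1%:R * (x ^+ k * phi x) - x ^+ k.+2 * phi x).
Proof.
have -> : (fun y => y ^+ k.+1 * phi y) =
    (id ^+ k.+1) * (normal_peak 1 \*: (expR \o (fun y : R => - y ^+ 2 / 2))).
  by apply/funext => y; rewrite normal_pdf01E /= !fctE /GRing.scale.
apply: is_derive_eq; rewrite normal_pdf01E /= !fctE /= /GRing.scale /=.
by rewrite !mulr0 add0r !mulr1 !exprS; field.
Qed.

Lemma continuous_power_pdf (k : nat) : continuous (fun x : R => x ^+ k * phi x).
Proof.
move=> x; apply: cvgM; first exact: exprn_continuous.
exact: continuous_normal_pdf (oner_neq0 _) x.
Qed.

(** The term of order [k.+2] of the exponential series at [x^2/2] is enough: it bounds the product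
    by a multiple of [x^-(k+3)]. *)
Lemma power_pdf_bound (k : nat) : exists C : R, forall n : nat,
  n.+1%:R ^+ k.+1 * phi n.+1%:R <= C * n.+1%:R^-1.
Proof.
exists (normal_peak 1 * ((k.+2`!)%:R * 2 ^+ k.+2)) => m.
set x : R := m.+1%:R; have x0 : 0 < x by rewrite ltr0n.
have x1 : 1 <= x by rewrite ler1n.
have y0 : 0 < x ^+ 2 / 2 by rewrite divr_gt0// exprn_gt0.
have fk : 0 < (k.+2`!)%:R :> R by rewrite ltr0n fact_gt0.
have e1 : (x ^+ 2 / 2) ^+ k.+2 / (k.+2`!)%:R <= expR (x ^+ 2 / 2).
  by rewrite (le_trans _ (expR_ge1Dxn k.+1 (ltW y0)))// lerDr.
have e2 : expR (- x ^+ 2 / 2) <= (k.+2`!)%:R / (x ^+ 2 / 2) ^+ k.+2.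
  rewrite mulNr expRN -[leRHS]invrK invf_div lef_pV2// posrE ?expR_gt0//.
  by rewrite divr_gt0// exprn_gt0.
have xk : x ^+ k.+1 * ((k.+2`!)%:R / (x ^+ 2 / 2) ^+ k.+2) =
    (k.+2`!)%:R * 2 ^+ k.+2 * x^-1 ^+ k.+3.
  have e3 : (x ^+ 2 / 2) ^+ k.+2 = x ^+ k.+1 * x ^+ k.+3 / 2 ^+ k.+2.
    by rewrite expr_div_n -exprM -exprD; congr (_ ^+ _ / _); lia.
  rewrite e3 exprVn; field.
  by rewrite !expf_neq0 ?pnatr_eq0// lt0r_neq0.
rewrite normal_pdf01E mulrCA -[leRHS]mulrA ler_wpM2l ?normal_peak_ge0//.
rewrite (le_trans (ler_wpM2l _ e2)) ?exprn_ge0 ?(ltW x0)//.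
rewrite xk; apply: ler_wpM2l.
  by apply: mulr_ge0 => //; exact: exprn_ge0.
rewrite exprS ler_piMr ?invr_ge0 ?(ltW x0)// exprn_ile1 ?invr_ge0 ?invf_le1// ltW.
Qed.

Lemma power_pdf_cvg0 (k : nat) :
  (n.+1%:R ^+ k.+1 * phi n.+1%:R) @[n --> \oo] --> (0 : R).
Proof.
have [C HC] := power_pdf_bound k.
apply: (@squeeze_cvgr _ _ _ _ (cst 0) (fun n => C * n.+1%:R^-1)).
- by near=> n; rewrite HC andbT mulr_ge0 ?exprn_ge0// normal_pdf_ge0.
- exact: cvg_cst.
- rewrite -[X in _ --> X](mulr0 C); apply: cvgM; first exact: cvg_cst.
  exact: cvg_harmonic.
Unshelve. all: by end_near. Qed.

Definition sym_itv (n : nat) : set R := `[- n.+1%:R, n.+1%:R]%classic.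

Lemma integral_power_pdf (k : nat) (n : nat) :
  (\int[mu]_(x in sym_itv n) (k.+1%:R * (x ^+ k * phi x) - x ^+ k.+2 * phi x)%R%:E =
  (n.+1%:R ^+ k.+1 * phi n.+1%:R)%R%:E - ((- n.+1%:R) ^+ k.+1 * phi (- n.+1%:R))%R%:E)%E.
Proof.
have dF (x : R) := is_derive_power_pdf k x.
apply: (@continuous_FTC2 _ _ (fun y => y ^+ k.+1 * phi y)).
- by rewrite (@lt_trans _ _ 0)// ?oppr_lt0 ltr0n.
- apply: continuous_subspaceT => x; apply: cvgB; last exact: continuous_power_pdf.
  by apply: cvgM; [exact: cvg_cst|exact: continuous_power_pdf].
- split.
  + by move=> x _; exact: (@ex_derive _ _ _ _ _ _ _ (dF x)).
  + exact/cvg_at_right_filter/continuous_power_pdf.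
  + exact/cvg_at_left_filter/continuous_power_pdf.
- by move=> x _; rewrite derive1E; exact: (@derive_val _ _ _ _ _ _ _ (dF x)).
Qed.

Lemma even_power_pdf_ge0 (k : nat) x : ~~ odd k -> 0 <= x ^+ k * phi x.
Proof. by move=> ek; rewrite mulr_ge0 ?normal_pdf_ge0// exprn_even_ge0. Qed.

Lemma cvg_integral_power_pdf (k : nat) : ~~ odd k ->
  (\int[mu]_(x in sym_itv n) (x ^+ k * phi x)%R%:E @[n --> \oo] -->
  \int[mu]_x (x ^+ k * phi x)%R%:E)%E.
Proof.
move=> ek.
have -> : [set: R] = \bigcup_n sym_itv n.
  apply/seteqP; split=> // x _; exists (Num.truncn `|x|) => //.
  rewrite /sym_itv /= in_itv/= -ler_norml ltW//; exact: truncnS_gt.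
apply: ge0_nondecreasing_set_cvg_integral.
- apply/nondecreasing_seqP => n; rewrite subsetEset; apply: subset_itvScc => /=;
  by rewrite ?bnd_simp ?lerN2 ler_nat.
- by move=> n; exact: measurable_itv.
- move=> n; apply/measurable_EFinP/measurable_funTS.
  by apply: continuous_measurable_fun; exact: continuous_power_pdf.
- by move=> n x _; rewrite lee_fin even_power_pdf_ge0.
Qed.

(** Integration by parts on [[-a, a]], then a limit. For even [k] the integrands are nonnegative, so
    monotone convergence gives the integral over the line together with its finiteness. *)
Lemma integral_normal_moment (k : nat) : ~~ odd k ->
  (\int[mu]_x (x ^+ k * phi x)%R%:E = (normal_moment k)%:E)%E.
Proof.
elim/ltn_ind: k => -[|[|k]] IH //.
  move=> _; rewrite -(integral_normal_pdf (0 : R) 1); apply: eq_integral => x _.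
  by rewrite expr0 mul1r.
rewrite /= negbK => ek.
have mI n : measurable (sym_itv n : set (measurableTypeR R)) by exact: measurable_itv.
have Ic f n : continuous f -> mu.-integrable (sym_itv n) (EFin \o f).
  move=> cf; apply: continuous_compact_integrable; first exact: segment_compact.
  exact: continuous_subspaceT.
have Ik j n := Ic _ n (@continuous_power_pdf j).
have Ikk n : mu.-integrable (sym_itv n) (EFin \o (fun x => k.+1%:R * (x ^+ k * phi x))).
  by apply: Ic => x; apply: cvgM; [exact: cvg_cst|exact: continuous_power_pdf].
pose b n : R := n.+1%:R ^+ k.+1 * phi n.+1%:R - (- n.+1%:R) ^+ k.+1 * phi (- n.+1%:R).
have b0 : b n @[n --> \oo] --> (0 : R).
  have -> : b = (fun n => 2 * (n.+1%:R ^+ k.+1 * phi n.+1%:R)).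
    apply/funext => n; rewrite /b !normal_pdf01E sqrrN exprNn -signr_odd /= ek /= expr1.
    by ring.
  rewrite -[X in _ --> X](mulr0 2); apply: cvgM; first exact: cvg_cst.
  exact: power_pdf_cvg0.
have E n : (\int[mu]_(x in sym_itv n) (x ^+ k.+2 * phi x)%R%:E =
    k.+1%:R%:E * \int[mu]_(x in sym_itv n) (x ^+ k * phi x)%R%:E - (b n)%:E)%E.
  have := integral_power_pdf k n; rewrite -EFinB -/(b n) => <-.
  rewrite (integralB_EFin (mI n) (Ikk n) (Ik k.+2 n)).
  have -> : (\int[mu]_(x in sym_itv n) (EFin \o (fun x => (k.+1%:R * (x ^+ k * phi x))%R)) x =
      k.+1%:R%:E * \int[mu]_(x in sym_itv n) (x ^+ k * phi x)%R%:E)%E.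
    by rewrite -(integralZl (mI n) (Ik k n)).
  have := integrable_fin_num (mI n) (Ik k n).
  have := integrable_fin_num (mI n) (Ik k.+2 n).
  move=> /fineK <- /fineK <-; rewrite -EFinM -!EFinB; congr EFin; ring.
have c2 := @cvg_integral_power_pdf k.+2 ltac:(by rewrite /= negbK).
have ca : (k.+1%:R%:E * \int[mu]_(x in sym_itv n) (x ^+ k * phi x)%R%:E @[n --> \oo] -->
    (k.+1%:R%:E * (normal_moment k)%:E))%E.
  by apply: cvgeZl => //; rewrite -(IH k)//; exact: cvg_integral_power_pdf.
have cb : (b n)%:E @[n --> \oo] --> (0%:E : \bar R).
  by apply: cvg_EFin; [exact: nearW|exact: b0].
have d0 : (k.+1%:R%:E * (normal_moment k)%:E +? - (0%:E : \bar R))%E by [].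
have c3 : (\int[mu]_(x in sym_itv n) (x ^+ k.+2 * phi x)%R%:E @[n --> \oo] -->
    (k.+1%:R%:E * (normal_moment k)%:E - 0%:E))%E.
  rewrite (eq_cvg _ _ E).
  exact: (@cvgeB _ \oo eventually_filter R _ _ _ _ d0 ca cb).
by rewrite (cvg_unique (@ereal_hausdorff R) c2 c3) sube0 -EFinM.
Qed.

Lemma normal_variable_moment (disp : measure_display) (T : measurableType disp)
    (P : probability T R) (N : {RV P >-> R}) (k : nat) :
  (forall A : set R, measurable A -> distribution P N A = normal_prob 0 1 A) ->
  ~~ odd k -> ('E_P[fun t => (N t ^+ k)%R] = (normal_moment k)%:E)%E.
Proof.
move=> NP ek; rewrite unlock.
have mk : measurable_fun [set: R] (fun x : R => (x ^+ k)%:E).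
  by apply/measurable_EFinP; exact: measurable_funX.
have k0 (y : R) : (0 <= (y ^+ k)%:E)%E by rewrite lee_fin exprn_even_ge0.
(* [normal_prob] is a measure on [measurableTypeR R], which differs from the
   default measurable structure of [R] by its display only. *)
have mN : measurable_fun [set: T] (N : T -> measurableTypeR R).
  exact: (measurable_funPT N).
pose N' : {mfun T >-> measurableTypeR R} :=
  HB.pack (N : T -> measurableTypeR R) (isMeasurableFun.Build _ _ _ _ _ mN).
have mk' : measurable_fun [set: measurableTypeR R] (fun x : R => (x ^+ k)%:E).
  exact: mk.
rewrite -[LHS](@ge0_integral_distribution _ _ T (measurableTypeR R) R P N' _ mk' k0).
rewrite (@eq_measure_integral _ _ _ _ (normal_prob (0 : R) (1 : R))); last first.
  by move=> A mA _; exact: NP.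
(* The change of variables yields the Radon-Nikodym derivative, which is almost everywhere the
   explicit density since both have the same integral over every measurable set. *)
have dom := @normal_prob_dominates R 0 1.
rewrite -(Radon_Nikodym_SigmaFinite.change_of_variables dom)//.
rewrite -integral_normal_moment//.
have mpdf : measurable_fun [set: R] (fun x : R => (phi x)%:E).
  by apply/measurable_EFinP; exact: measurable_normal_pdf.
have mRN : measurable_fun [set: R] (Radon_Nikodym_SigmaFinite.f (normal_prob (0 : R) (1 : R)) mu).
  exact: measurable_int (Radon_Nikodym_SigmaFinite.f_integrable dom).
transitivity (\int[mu]_x ((x ^+ k)%:E * (phi x)%:E)%E)%E; last first.
  by apply: eq_integral => x _; rewrite -EFinM.
apply: ae_eq_integral => //.
- exact: emeasurable_funM.
- exact: emeasurable_funM.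
- apply: ae_eqe_mul2l; apply: integral_ae_eq => //.
  + exact: Radon_Nikodym_SigmaFinite.f_integrable.
  + by move=> A _ mA; rewrite -Radon_Nikodym_SigmaFinite.f_integral.
Qed.

End normal_moments.

(** * Variance in finite volume *)

Section neighbours.
Context {d : nat}.
Implicit Types (x y : lattice d) (e : {fset lattice d}).

(** Covers the bonds at [x] by means of the whole cube of side 3 around [x]; this is the origin of
    the constant [3 ^ d]. *)
Definition bond_star x : seq {fset lattice d} :=
  [seq [fset x; (x + z)%R]%fset | z <- box_seq 1].

Lemma size_bond_star x : size (bond_star x) = (3 ^ d)%N.
Proof. by rewrite size_map size_box_seq. Qed.

Lemma dist1_box x y : (dist x y <= 1)%N -> y - x \in box_seq 1.
Proof.
move=> xy; apply/mem_box_seq => k; rewrite !ffunE.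
have : (`|(x k - y k)%R| <= dist x y)%N.
  by rewrite /dist (bigD1 k)//= leq_addr.
move/leq_trans/(_ xy); move: (x k) (y k) => /= u v; lia.
Qed.

Lemma mem_bond_star x e : is_bond e -> x \in e -> e \in bond_star x.
Proof.
have star y : dist x y = 1%N -> [fset x; y]%fset \in bond_star x.
  move=> xy; apply/mapP; exists (y - x); last by rewrite addrC subrK.
  by rewrite dist1_box// xy.
move=> [a [b [+ ->]]]; rewrite l1distE => -[ab]; rewrite !inE => /orP[]/eqP xE.
  by rewrite xE in star *; exact: star.
by rewrite xE in star *; rewrite fsetUC; apply: star; rewrite dist_sym.
Qed.

Lemma finite_bonds_meeting (L : {fset lattice d}) : finite_set (bonds_meeting L).
Proof.
apply: (@sub_finite_set _ _ [set` flatten [seq bond_star x | x <- enum_fset L]]).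
  move=> e [be [x xe xL]] /=; apply/flattenP; exists (bond_star x).
    exact: map_f.
  exact: mem_bond_star.
exact: finite_seq.
Qed.

Lemma bond_dist_le1 x y e : is_bond e -> x \in e -> y \in e -> (dist x y <= 1)%N.
Proof.
move=> [a [b [+ ->]]]; rewrite l1distE => -[ab].
rewrite !inE => /orP[]/eqP -> /orP[]/eqP ->; rewrite ?distxx// ?ab//.
by rewrite dist_sym ab.
Qed.

Lemma count_neighbours (s : seq (lattice d)) x : uniq s ->
  (\sum_(y <- s) (dist x y <= 1)%N <= 3 ^ d)%N.
Proof.
move=> us; rewrite -(size_box_seq (d := d) 1).
have -> : (\sum_(y <- s) (dist x y <= 1) = size [seq (y - x)%R | y <- s & dist x y <= 1])%N.
  by rewrite size_map size_filter -sum1_count [RHS]big_mkcond; apply: eq_bigr => y _; case: leqP.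
apply: uniq_leq_size; first by rewrite map_inj_uniq ?filter_uniq//; exact: subIr.
by move=> z /mapP[y]; rewrite mem_filter => /andP[xy _ ->]; exact: dist1_box.
Qed.

End neighbours.

Lemma spin_norm (R : realType) b : `|spin R b| = 1.
Proof. by case: b; rewrite /spin ?normrN normr1. Qed.

Section finite_volume.
Context {R : realType} {d : nat} (beta h : R) (L : {fset lattice d}).
Implicit Types (x y : lattice d) (w : config d).

Notation H := (hamiltonian beta h L).

Definition flip x w : config d := fun y => if y == x then ~~ w y else w y.

Lemma flipK x : involutive (flip x).
Proof. by move=> w; apply/funext => y; rewrite /flip; case: eqP; rewrite ?negbK. Qed.

Lemma spin_flip x w : spin R (flip x w x) = - spin R (w x).
Proof. by rewrite /flip eqxx /spin; case: (w x); rewrite /= ?opprK. Qed.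

Lemma spin_flip_neq x y w : y != x -> spin R (flip x w y) = spin R (w y).
Proof. by move=> /negPf yx; rewrite /flip yx. Qed.

Definition bond_seq : seq {fset lattice d} := fset_set (@bonds_meeting d L).

Lemma bond_seqP e : e \in bond_seq -> is_bond e.
Proof.
rewrite /bond_seq in_fset_set; last exact: finite_bonds_meeting.
by rewrite inE => -[].
Qed.

Definition bond_energy w (e : {fset lattice d}) : R := \prod_(x <- e) spin R (w x).

Lemma bond_energy_flip x w e :
  bond_energy (flip x w) e = if x \in e then - bond_energy w e else bond_energy w e.
Proof.
rewrite /bond_energy; case: ifPn => xe.
  rewrite (big_fsetD1 x)//= [in RHS](big_fsetD1 x)//= spin_flip mulNr.
  congr (- (_ * _)); apply: eq_big_seq => y; rewrite !inE => /andP[yx _].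
  exact: spin_flip_neq.
apply: eq_big_seq => y ye; apply: spin_flip_neq; apply: contraNneq xe => <-.
exact: ye.
Qed.

Lemma bond_energy_norm w e : `|bond_energy w e| = 1.
Proof.
by rewrite normr_prod big1// => x _; exact: spin_norm.
Qed.

(** The logarithm of the ratio of the Gibbs weights of [flip x w] and [w]. *)
Definition flip_energy x w : R := H w - H (flip x w).

Lemma flip_energyE x w : flip_energy x w =
  - 2 * beta * (\sum_(e <- bond_seq | x \in e) bond_energy w e) -
  2 * h * (if x \in L then spin R (w x) else 0).
Proof.
have E u : H u = - beta * (\sum_(e <- bond_seq) bond_energy u e) -
    h * (\sum_(y <- L) spin R (u y)).
  by rewrite /hamiltonian fsbig_finite//; exact: finite_bonds_meeting.
have E1 : \sum_(e <- bond_seq) bond_energy (flip x w) e =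
    \sum_(e <- bond_seq) bond_energy w e -
    2 * \sum_(e <- bond_seq | x \in e) bond_energy w e.
  rewrite [X in _ - 2 * X]big_mkcond mulr_sumr -sumrB; apply: eq_bigr => e _.
  by rewrite bond_energy_flip; case: ifP => _; ring.
have E2 : \sum_(y <- L) spin R (flip x w y) = \sum_(y <- L) spin R (w y) -
    2 * (if x \in L then spin R (w x) else 0).
  case: ifPn => xL.
    rewrite (big_fsetD1 x)//= [in RHS](big_fsetD1 x)//= spin_flip.
    rewrite [X in _ + X](_ : _ = \sum_(y <- (L `\ x)%fset) spin R (w y)); first by ring.
    by apply: eq_big_seq => y; rewrite !inE => /andP[yx _]; exact: spin_flip_neq.
  rewrite mulr0 subr0; apply: eq_big_seq => y yL; apply: spin_flip_neq.
  by apply: contraNneq xL => <-.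
by rewrite /flip_energy !E E1 E2; ring.
Qed.

(** Independent of [L], which makes the variance bound uniform in the volume. *)
Definition flip_bound : R := 2 * `|beta| * (3 ^ d)%:R + 2 * `|h|.

Lemma flip_energy_bound x w : `|flip_energy x w| <= flip_bound.
Proof.
rewrite flip_energyE (le_trans (ler_normB _ _))// lerD//.
  rewrite !normrM normrN normr_nat ler_wpM2l ?mulr_ge0//.
  rewrite (le_trans (ler_norm_sum _ _ _))//.
  under eq_bigr do rewrite bond_energy_norm.
  rewrite (_ : \sum_(e <- bond_seq | x \in e) 1 = (count (fun e => x \in e) bond_seq)%:R).
    rewrite -(size_bond_star x) ler_nat -size_filter.
    apply: uniq_leq_size; first by rewrite filter_uniq// fset_uniq.
    move=> e; rewrite mem_filter => /andP[xe /bond_seqP be].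
    exact: mem_bond_star.
  by rewrite -sum1_count natr_sum.
rewrite !normrM normr_nat ler_piMr ?mulr_ge0//.
by case: ifP => _; rewrite ?normr0// spin_norm.
Qed.

Lemma flip_energy_local x y w : (1 < dist x y)%N ->
  flip_energy y (flip x w) = flip_energy y w.
Proof.
move=> xy; have yx : y != x.
  by apply: contraTneq xy => ->; rewrite distxx.
rewrite !flip_energyE spin_flip_neq//; congr (- 2 * _ * _ - _).
rewrite big_seq_cond [RHS]big_seq_cond; apply: eq_bigr => e /andP[eb ye].
rewrite bond_energy_flip ifN//; apply: contraTN xy => xe.
by rewrite -leqNgt; exact: bond_dist_le1 (bond_seqP eb) xe ye.
Qed.

Definition plus_seq : seq (config d) := fset_set (@plus_configs d L).

Lemma mem_plus_seq w : (w \in plus_seq) = `[< plus_configs L w >].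
Proof.
rewrite /plus_seq in_fset_set; last exact: finite_plus_configs.
by apply/idP/asboolP; rewrite inE.
Qed.

Lemma plus_seq_flip x : x \in L -> perm_eq [seq flip x w | w <- plus_seq] plus_seq.
Proof.
move=> xL; apply: uniq_perm.
- by rewrite map_inj_uniq ?fset_uniq//; exact: (can_inj (flipK x)).
- exact: fset_uniq.
have mflip w : w \in plus_seq -> flip x w \in plus_seq.
  rewrite !mem_plus_seq => /asboolP wp; apply/asboolP => y yL.
  by rewrite /flip ifN ?wp//; apply: contraNneq yL => ->.
move=> w; apply/mapP/idP => [[u up ->]|wp]; first exact: mflip.
by exists (flip x w); rewrite ?flipK// mflip.
Qed.

Definition gibbs_weight w : R := expR (- H w) / partition_function beta h L.

Definition gibbs_sum (f : config d -> R) : R :=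
  \sum_(w <- plus_seq) gibbs_weight w * f w.

Lemma gibbs_weight_ge0 w : 0 <= gibbs_weight w.
Proof. by rewrite divr_ge0 ?expR_ge0// ltW// partition_function_gt0. Qed.

Lemma gibbs_sum1 : gibbs_sum (fun=> 1) = 1.
Proof.
rewrite /gibbs_sum; under eq_bigr do rewrite mulr1.
have ZE : partition_function beta h L = \sum_(w <- plus_seq) expR (- H w).
  by rewrite /partition_function fsbig_finite//; exact: finite_plus_configs.
by rewrite -mulr_suml -ZE divff// lt0r_neq0// partition_function_gt0.
Qed.

Lemma gibbs_sum_lin (a b : R) f g : gibbs_sum (fun w => a * f w + b * g w) =
  a * gibbs_sum f + b * gibbs_sum g.
Proof.
by rewrite /gibbs_sum !mulr_sumr -big_split; apply: eq_bigr => w _ /=; ring.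
Qed.

Lemma gibbs_sum_cst c : gibbs_sum (fun=> c) = c.
Proof.
by rewrite -[RHS]mulr1 -gibbs_sum1 /gibbs_sum mulr_sumr; apply: eq_bigr => w _; ring.
Qed.

Lemma gibbs_sum_sum (I : Type) (r : seq I) (f : I -> config d -> R) :
  gibbs_sum (fun w => \sum_(i <- r) f i w) = \sum_(i <- r) gibbs_sum (f i).
Proof.
rewrite /gibbs_sum exchange_big; apply: eq_bigr => w _ /=.
by rewrite mulr_sumr.
Qed.

Lemma ler_gibbs_sum f g : (forall w, f w <= g w) -> gibbs_sum f <= gibbs_sum g.
Proof. by move=> fg; apply: ler_sum => w _; rewrite ler_wpM2l ?gibbs_weight_ge0. Qed.

(* The weight of [w] times [flip_score x w] changes sign when the spin at [x]
   is flipped. *)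
Definition flip_score x w : R := spin R (w x) * expR (flip_energy x w / 2).

(** Weight times score is the spin at [x] times the geometric mean of the weights of [w] and
    [flip x w], hence odd under the flip. As [x] is in [L], the flip permutes the admissible
    configurations. *)
Lemma gibbs_sum_flip_score x f : x \in L -> (forall w, f (flip x w) = f w) ->
  gibbs_sum (fun w => flip_score x w * f w) = 0.
Proof.
move=> xL fx.
have anti w : gibbs_weight (flip x w) * flip_score x (flip x w) =
    - (gibbs_weight w * flip_score x w).
  rewrite /gibbs_weight /flip_score spin_flip /flip_energy flipK.
  have -> : expR (- H (flip x w)) = expR (- H w) * (expR ((H w - H (flip x w)) / 2) *
      expR ((H w - H (flip x w)) / 2)).
    by rewrite -!expRD; congr expR; field.
  rewrite (_ : (H (flip x w) - H w) / 2 = - ((H w - H (flip x w)) / 2)); last by field.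
  rewrite (expRN ((H w - H (flip x w)) / 2)).
  have e0 := expR_gt0 ((H w - H (flip x w)) / 2).
  move: (expR _) (partition_function _ _ _)^-1 (expR (- H w)) e0 => e z u e0.
  by field; exact: lt0r_neq0.
have E : gibbs_sum (fun w => flip_score x w * f w) =
    - gibbs_sum (fun w => flip_score x w * f w).
  rewrite {1}/gibbs_sum -(perm_big _ (plus_seq_flip xL)) big_map -sumrN.
  by apply: eq_bigr => w _; rewrite fx mulrA anti mulrA mulNr.
lra.
Qed.

Lemma flip_score_norm x w : `|flip_score x w| <= expR (flip_bound / 2).
Proof.
rewrite normrM (ger0_norm (expR_ge0 _)).
rewrite spin_norm mul1r ler_expR ler_pM2r//.
exact: le_trans (ler_norm _) (flip_energy_bound x w).
Qed.

(* [E (S - m - t G)^2 >= 0] for the sum [G] of the scores, which are correlated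
   with [S] and among themselves only at distance at most one. *)
Lemma gibbs_variance_ge (s : seq (lattice d)) :
  uniq s -> {subset s <= L} ->
  (expR (- flip_bound) / (expR flip_bound * (3 ^ d)%:R)) * (size s)%:R <=
  gibbs_sum (fun w => (\sum_(x <- s) spin R (w x)) ^+ 2) -
  (gibbs_sum (fun w => \sum_(x <- s) spin R (w x))) ^+ 2.
Proof.
move=> us sL; set S := fun w => \sum_(x <- s) spin R (w x).
set m := gibbs_sum S; pose G w := \sum_(x <- s) flip_score x w.
(* [a] bounds from below the correlation of a spin with its own score. [b] bounds the sum over [y]
   of the correlations of the scores at [x] and [y]: at most [3 ^ d] sites, each contributing at
   most the squared supremum of a score. *)
pose a := expR (- (flip_bound / 2)); pose b := expR flip_bound * (3 ^ d)%:R : R.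
have b0 : 0 < b by rewrite mulr_gt0 ?expR_gt0// ltr0n expn_gt0.
have score0 x : x \in s -> gibbs_sum (flip_score x) = 0.
  move=> xs; rewrite -(gibbs_sum_flip_score (f := fun=> 1) (sL _ xs))//.
  by congr gibbs_sum; apply/funext => w; rewrite mulr1.
have EG : gibbs_sum G = 0.
  by rewrite gibbs_sum_sum big_seq big1// => x xs; exact: score0.
have ESG : a * (size s)%:R <= gibbs_sum (fun w => S w * G w).
  have -> : gibbs_sum (fun w => S w * G w) =
      \sum_(x <- s) gibbs_sum (fun w => flip_score x w * S w).
    rewrite -gibbs_sum_sum; congr gibbs_sum; apply/funext => w.
    by rewrite mulr_sumr; apply: eq_bigr => x _; rewrite mulrC.
  rewrite mulr_natr -[_ *+ _]addr0 -iter_addr -(count_predT s) -big_const_seq.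
  rewrite big_seq [leRHS]big_seq; apply: ler_sum => x xs.
  have -> : gibbs_sum (fun w => flip_score x w * S w) =
      gibbs_sum (fun w => expR (flip_energy x w / 2)) +
      gibbs_sum (fun w => flip_score x w * \sum_(y <- s | y != x) spin R (w y)).
    rewrite -[X in X + _]mul1r -[X in _ + X]mul1r -gibbs_sum_lin.
    congr gibbs_sum; apply/funext => w; rewrite /S (bigD1_seq x)//= !mul1r mulrDr.
    congr (_ + _); rewrite /flip_score mulrAC /spin.
    by case: (w x); rewrite ?mulrNN !mul1r.
  rewrite gibbs_sum_flip_score ?sL//; last first.
    by move=> w; apply: eq_bigr => y yx; exact: spin_flip_neq.
  rewrite addr0 -[leLHS]gibbs_sum_cst; apply: ler_gibbs_sum => w; rewrite ler_expR.
  have := flip_energy_bound x w; rewrite ler_norml => /andP[? _]; lra.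
have EGG : gibbs_sum (fun w => G w ^+ 2) <= b * (size s)%:R.
  have -> : gibbs_sum (fun w => G w ^+ 2) =
      \sum_(x <- s) \sum_(y <- s) gibbs_sum (fun w => flip_score x w * flip_score y w).
    under eq_bigr do rewrite -gibbs_sum_sum.
    rewrite -gibbs_sum_sum; congr gibbs_sum; apply/funext => w.
    by rewrite expr2 mulr_suml; apply: eq_bigr => x _; rewrite mulr_sumr.
  rewrite mulr_natr -[_ *+ _]addr0 -iter_addr -(count_predT s) -big_const_seq.
  rewrite big_seq [leRHS]big_seq; apply: ler_sum => x xs.
  rewrite (le_trans _ (ler_wpM2l (expR_ge0 _) (_ : (\sum_(y <- s) (dist x y <= 1)%N)%:R <= _)))//; last first.
    by rewrite ler_nat; exact: count_neighbours.
  rewrite natr_sum mulr_sumr; apply: ler_sum => y _.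
  case: leqP => [_|xy]; rewrite ?mulr1 ?mulr0.
    rewrite -[leRHS]gibbs_sum_cst; apply: ler_gibbs_sum => w.
    rewrite (le_trans (ler_norm _))// normrM.
    rewrite (le_trans (ler_pM _ _ (flip_score_norm x w) (flip_score_norm y w)))//.
    by rewrite -expRD ler_expR; lra.
  rewrite gibbs_sum_flip_score ?sL// => w.
  by rewrite /flip_score flip_energy_local// spin_flip_neq//;
    apply: contraTneq xy => ->; rewrite distxx.
have quad t : 0 <= gibbs_sum (fun w => S w ^+ 2) - m ^+ 2 -
    2 * t * gibbs_sum (fun w => S w * G w) + t ^+ 2 * gibbs_sum (fun w => G w ^+ 2).
  have -> : gibbs_sum (fun w => S w ^+ 2) - m ^+ 2 -
      2 * t * gibbs_sum (fun w => S w * G w) + t ^+ 2 * gibbs_sum (fun w => G w ^+ 2) =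
      gibbs_sum (fun w => (S w - m - t * G w) ^+ 2).
    transitivity (gibbs_sum (fun w => 1 * (1 * (1 * S w ^+ 2 + (- 2 * m) * S w) +
       (m ^+ 2) * 1) + 1 * ((- 2 * t) * (S w * G w) + 1 * ((2 * t * m) * G w + t ^+ 2 * G w ^+ 2)))).
      by rewrite !gibbs_sum_lin gibbs_sum1 EG -/m; ring.
    by congr gibbs_sum; apply/funext => w; ring.
  by rewrite -[leLHS]gibbs_sum_cst; apply: ler_gibbs_sum => w; exact: sqr_ge0.
have a0 : 0 < a by exact: expR_gt0.
have aa : expR (- flip_bound) = a ^+ 2.
  by rewrite expr2 -expRD; congr expR; field.
(* The variance is at least [(2 t a - t^2 b)] times the number of sites; [t = a / b] is the
   maximizer. *)
have := quad (a / b); rewrite aa.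
move: (gibbs_sum (fun w => S w ^+ 2)) (gibbs_sum (fun w => S w * G w))
  (gibbs_sum (fun w => G w ^+ 2)) ((size s)%:R : R) ESG EGG => VS SG GG n ESG EGG.
move=> q.
have h1 : 2 * (a / b) * (a * n) <= 2 * (a / b) * SG.
  by rewrite ler_wpM2l// mulr_ge0// divr_ge0// ltW.
have h2 : (a / b) ^+ 2 * GG <= (a / b) ^+ 2 * (b * n).
  by rewrite ler_wpM2l// sqr_ge0.
have h3 : 2 * (a / b) * (a * n) - (a / b) ^+ 2 * (b * n) = a ^+ 2 / b * n.
  by field; exact: lt0r_neq0.
rewrite -/b; lra.
Qed.

End finite_volume.

(** * Infinite volume *)

Section configurations.
Context {R : realType} {d : nat}.

Lemma continuous_measurable_config (f : config d -> R) :
  continuous f -> measurable_fun setT f.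
Proof.
move=> cf; apply: (measurability _ (RGenOInfty.measurableE R)).
move=> /= _ [_ [a ->] <-]; apply: measurableI => //.
apply: sub_sigma_algebra; apply: open_comp => //; exact: interval_open.
Qed.

Lemma continuous_spin (x : lattice d) : continuous (fun w : config d => spin R (w x)).
Proof.
move=> w; apply: (@continuous_comp _ _ _ (fun w : config d => w x) (spin R)).
  exact: (@proj_continuous _ (fun _ : lattice d => bool) x).
move=> A /= sA; apply: open_nbhs_nbhs; split; first exact: discrete_open.
exact: (nbhs_singleton sA).
Qed.

Lemma continuous_sum_spin (s : seq (lattice d)) :
  continuous (fun w : config d => \sum_(x <- s) spin R (w x)).
Proof.
elim: s => [|x s IH] w.
  have -> : (fun w : config d => \sum_(x <- [::]) spin R (w x)) = cst 0.
    by apply/funext => u; rewrite big_nil.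
  exact: cst_continuous.
have -> : (fun w : config d => \sum_(y <- x :: s) spin R (w y)) =
    (fun w => spin R (w x) + \sum_(y <- s) spin R (w y)).
  by apply/funext => u; rewrite big_cons.
by apply: cvgD; [exact: continuous_spin|exact: IH].
Qed.

Lemma bounded_measurable_spin (x : lattice d) :
  bounded_measurable (fun w : config d => spin R (w x)).
Proof.
split; first by apply: continuous_measurable_config; exact: continuous_spin.
by exists 1 => w; rewrite spin_norm.
Qed.

Lemma expectation_gibbs_plus (beta h : R) (L : {fset lattice d}) (f : config d -> R) :
  bounded_measurable f ->
  ('E_(gibbs_plus beta h L)[f] = (gibbs_sum beta h L f)%:E)%E.
Proof.
have nonneg (g : config d -> R) : measurable_fun setT g -> (forall w, 0 <= g w) ->
    ('E_(gibbs_plus beta h L)[g] = (gibbs_sum beta h L g)%:E)%E.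
  move=> mg g0; pose s := plus_seq L.
  pose diracs (k : nat) : {measure set (config d) -> \bar R} :=
    mscale (NngNum (gibbs_weight_ge0 beta h L (nth point s k))) (dirac (nth point s k)).
  have gE A : gibbs_plus beta h L A = msum diracs (size s) A.
    rewrite /gibbs_plus /msum.
    have -> : \sum_(w \in plus_configs L `&` A) expR (- hamiltonian beta h L w)
          / partition_function beta h L =
        \sum_(w \in plus_configs L) gibbs_weight beta h L w * \1_A w.
      rewrite fsbig_mkcondr; apply: eq_fsbigr => w _.
      by rewrite indicE; case: ifP; rewrite ?mulr1 ?mulr0.
    rewrite fsbig_finite /=; last exact: finite_plus_configs.
    by rewrite (big_nth point) big_mkord -sumEFin.
  have mg' : measurable_fun setT (fun w => (g w)%:E) by exact/measurable_EFinP.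
  rewrite unlock (@eq_measure_integral _ _ _ _ (msum diracs (size s))); last first.
    by move=> A _ _; exact: gE.
  rewrite ge0_integral_measure_sum//; last by move=> w _; rewrite lee_fin.
  rewrite /gibbs_sum (big_nth point) big_mkord -sumEFin; apply: eq_bigr => i _.
  rewrite ge0_integral_mscale//; last by move=> w _; rewrite lee_fin.
  by rewrite integral_dirac// diracT mul1e EFinM.
move=> bf; have [mf [M fM]] := bf.
(* Adding the bound [M] reduces to the nonnegative case, where the integral against a sum of Dirac
   masses splits. *)
have fE : f = fun w => 1 * (f w + M) + (- M) * 1 by apply/funext => w; ring.
have bM : bounded_measurable (fun w => f w + M).
  by apply: bounded_measurableD => //; exact: bounded_measurable_cst.
rewrite expectation_bounded// [in LHS]fE [in RHS]fE.
rewrite fine_expectation_lin//; last exact: bounded_measurable_cst.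
rewrite gibbs_sum_lin gibbs_sum_cst expectation_cst nonneg//; first by case: bM.
by move=> w; rewrite -lerBlDr sub0r; have := fM w; rewrite ler_norml => /andP[].
Qed.

Definition box_fset (n : nat) : {fset lattice d} := [fset x in box_seq n]%fset.

Lemma box_subset n m : (n <= m)%N -> {subset @box_seq d n <= box_seq m}.
Proof.
move=> nm x /mem_box_seq xn; apply/mem_box_seq => k.
by rewrite (le_trans (xn k))// lez_nat.
Qed.

(** [S] depends on finitely many spins, so its powers are continuous and weak convergence applies to
    its first two moments. The volumes are boxes of radius [m], and the finite-volume bound is used
    once [m >= n]. *)
Lemma variance_ge (beta h : R) (mu : probability (config d) R) (n : nat)
    (S : config d -> R := magnetization n) : is_plus_state beta h mu ->
  expR (- @flip_bound R d beta h) / (expR (@flip_bound R d beta h) * (3 ^ d)%:R)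
    * ((2 * n + 1) ^ d)%:R <=
  moment mu S 2 - moment mu S 1 ^+ 2.
Proof.
move=> mu_plus; set c := _ / _.
have SE : S = fun w : config d => \sum_(x <- box_seq n) spin R (w x).
  by apply/funext => w; exact: magnetizationE.
have cS : continuous S by rewrite SE; exact: continuous_sum_spin.
have bS : bounded_measurable S.
  by rewrite SE; apply: bounded_measurable_sum => x; exact: bounded_measurable_spin.
have cvg_moment k : gibbs_sum beta h (box_fset m) (fun w => S w ^+ k) @[m --> \oo] -->
    moment mu S k.
  have cSk : continuous (fun w => S w ^+ k).
    by move=> w; apply: (@continuous_comp _ _ _ S (fun x => x ^+ k)); [exact: cS|exact: exprn_continuous].
  have bSk : bounded_measurable (fun w => S w ^+ k) by exact: bounded_measurableX.
  have incr m : (box_fset m `<=` box_fset m.+1)%fset.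
    by apply/fsubsetP => x; rewrite !inE; exact: box_subset.
  have exhaust x : exists m, x \in box_fset m.
    exists (\sum_k `|x k|)%N; rewrite !inE; apply/mem_box_seq => i.
    by rewrite -abszE lez_nat (bigD1 i)//= leq_addr.
  have := mu_plus box_fset incr exhaust _ cSk.
  rewrite expectation_bounded// -/(moment mu S k).
  rewrite (eq_cvg _ _ (fun m => expectation_gibbs_plus beta h (box_fset m) bSk)).
  by move/fine_cvg.
have lim : gibbs_sum beta h (box_fset m) (fun w => S w ^+ 2) -
    (gibbs_sum beta h (box_fset m) (fun w => S w ^+ 1)) ^+ 2 @[m --> \oo] -->
    moment mu S 2 - moment mu S 1 ^+ 2.
  apply: cvgB; first exact: cvg_moment.
  by rewrite expr2; under eq_fun do rewrite expr2; apply: cvgM; exact: cvg_moment.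
apply: (cvgr_to_ge lim); exists n => // m /= nm.
rewrite SE -(@size_box_seq d n).
have := @gibbs_variance_ge R d beta h (box_fset m) (box_seq n) (uniq_box_seq n).
under [X in _ -> is_true (_ <= _ - gibbs_sum _ _ _ X ^+ 2)]eq_fun do rewrite expr1.
by apply => x xn; rewrite !inE (box_subset nm).
Qed.

End configurations.

(** * Cumulants of the magnetization and comparison with the normal moments *)

Lemma cumulant_box_bound (R : realType) (d : nat) (eps : R)
    (mu : probability (config d) R) :
  0 < eps < 1 ->
  (forall j : nat, (0 < j)%N -> exists Cj : R, forall x : 'I_j -> lattice d,
    `|joint_cumulant mu (fun k (w : config d) => spin R (w (x k)))|
      <= Cj * eps ^+ tree_length [fset x k | k in 'I_j]%fset) ->
  forall j, exists A : R, forall n,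
    `|joint_cumulant mu (fun _ : 'I_j.+1 => magnetization n)| <=
    A * ((2 * n + 1) ^ d)%:R.
Proof.
move=> eps01 decay j; have [C HC] := decay j.+1 isT.
have [q /andP[q0 q1] epsq] := root_bound j eps01.
(* [q] depends on [j] but not on [n], and each of the [j] points after the first contributes a
   geometric sum over the lattice. *)
exists (`|C| * ((2 / (1 - q)) ^+ d) ^+ j) => n.
have -> : magnetization n = (fun w : config d => \sum_(x <- box_seq n) spin R (w x)).
  by apply/funext => w; exact: magnetizationE.
rewrite -(@size_box_seq d n).
apply: (@cumulant_sum_bound _ _ R mu _ (box_seq n) (fun x (w : config d) => spin R (w x))
  j (fun x y => q ^+ dist x y)) => //.
- exact: bounded_measurable_spin.
- move=> x; rewrite (le_trans (HC x))//.
  rewrite (le_trans (ler_wpM2r _ (ler_norm C)))//.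
    by rewrite exprn_ge0// ltW//; case/andP: eps01.
  rewrite ler_wpM2l//; apply: exp_tree_length_le => //.
    by rewrite ltW//; case/andP: eps01.
  by rewrite q0 ltW.
- by move=> x y; exact: exprn_ge0.
- by move=> x; rewrite distxx expr0.
- by move=> x; apply: geometric_box_sum; rewrite q0.
Qed.

Section standardized_moments.
Context {disp : measure_display} {T : measurableType disp} {R : realType}.
Context (P : probability T R) (S : T -> R).
Hypothesis bS : bounded_measurable S.

Lemma moment1 : moment P S 1 = fine ('E_P[S])%E.
Proof. by []. Qed.

Lemma variance_moment : fine ('V_P[S])%E = moment P S 2 - moment P S 1 ^+ 2.
Proof.
rewrite moment1; set c := fine ('E_P[S])%E.
transitivity (fine ('E_P[fun w =>
    (1 * S w ^+ 2 + 1 * ((- 2 * c) * S w + c ^+ 2 * 1))%R])%E).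
  rewrite /variance unlock -/c; congr (fine (expectation _ _)); apply/funext => w.
  by rewrite !fctE /=; ring.
have b1 := @bounded_measurable_cst _ T R 1.
have bZ a f : bounded_measurable f -> bounded_measurable (fun w : T => a * f w).
  by apply: bounded_measurableM; exact: bounded_measurable_cst.
rewrite !fine_expectation_lin//; last 2 first.
- exact: bounded_measurableX.
- by apply: bounded_measurableD; exact: bZ.
rewrite expectation_cst.
transitivity (1 * moment P S 2 + 1 * (- 2 * c * c + c ^+ 2 * 1)); first by [].
by ring.
Qed.

Lemma standardized_cumulant2 (s : R) : s != 0 ->
  s ^+ 2 = moment P S 2 - moment P S 1 ^+ 2 ->
  joint_cumulant P (fun _ : 'I_2 => S) / s ^+ 2 = 1.
Proof.
move=> s0 sE; have := moment_cumulant P S 1.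
have := moment_cumulant P S 0.
rewrite !big_ord_recl !big_ord0 /= !bin0 !addr0 !mul1r moment0 mulr1 => <-.
rewrite mulr1 => m2.
have -> : joint_cumulant P (fun _ : 'I_2 => S) = s ^+ 2.
  by rewrite sE m2 expr2 addrC addKr.
by rewrite divff// expf_neq0.
Qed.

Lemma standardized_bounded (c s : R) : bounded_measurable (standardized S c s).
Proof.
apply: bounded_measurableM; last exact: bounded_measurable_cst.
by apply: bounded_measurableD => //; exact: bounded_measurable_cst.
Qed.

End standardized_moments.

Lemma standardized_moment_comparison (R : realType) (c0 : R) (A : nat -> R) (k : nat) :
  0 < c0 -> ~~ odd k ->
  exists D : R, forall (disp : measure_display) (T : measurableType disp)
    (P : probability T R) (S : T -> R) (v : R),
  bounded_measurable S -> 1 <= v ->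
  c0 * v <= fine ('V_P[S])%E ->
  (forall j, `|joint_cumulant P (fun _ : 'I_j.+1 => S)| <= A j * v) ->
  `|moment P (standardized S (fine ('E_P[S])%E) (Num.sqrt (fine ('V_P[S])%E))) k
    - normal_moment k| <= D / v.
Proof.
move=> c0_gt0 ek.
(* [A j] bounds the cumulant of order [j.+1], whence the predecessor. The power of [Num.sqrt c0]
   comes from dividing by the standard deviation, which is at least [Num.sqrt (c0 * v)]. *)
pose C j := `|A j.-1| / Num.sqrt c0 ^+ j.
have [D HD] := @gaussian_moment_comparison R normal_moment C erefl erefl
  (fun k => erefl) k.
exists D => disp T P S v bS v1 Vge kA.
set s := Num.sqrt _; have v0 : 0 < v by exact: lt_le_trans v1.
have V0 : 0 < fine ('V_P[S])%E by rewrite (lt_le_trans _ Vge)// mulr_gt0.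
have s_gt0 : 0 < s by rewrite sqrtr_gt0.
have s0 : s != 0 := lt0r_neq0 s_gt0.
have s2 : s ^+ 2 = moment P S 2 - moment P S 1 ^+ 2.
  by rewrite sqr_sqrtr ?ltW// variance_moment.
pose rho := (Num.sqrt v)^-1.
have sv : 0 < Num.sqrt v by rewrite sqrtr_gt0.
have sc : 0 < Num.sqrt c0 by rewrite sqrtr_gt0.
have rho2 : rho ^+ 2 = v^-1 by rewrite exprVn sqr_sqrtr// ltW.
pose lam j := joint_cumulant P (fun _ : 'I_j => S) / s ^+ j.
have := HD rho (moment P (standardized S (fine ('E_P[S])%E) s)) lam _ _ _ _ _ _ k (leqnn k).
rewrite (negPf ek) rho2; apply.
- by rewrite invr_ge0 ltW//= invf_le1// -[leLHS]sqrtr1 ler_sqrt// ltW.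
- exact: moment0.
(* The recursion for the first moment is an empty sum. *)
- by rewrite -moment1 standardized_recursion// big_geq.
- exact: standardized_cumulant2.
- move=> [//|j] j3; rewrite /lam /C /= normrM normfV (ger0_norm (exprn_ge0 _ (ltW s_gt0))).
  have sge : Num.sqrt c0 * Num.sqrt v <= s.
    by rewrite -sqrtrM ?(ltW c0_gt0)// ler_sqrt// ltW.
  have kAj := le_trans (kA j) (ler_wpM2r (ltW v0) (ler_norm (A j))).
  apply: (@le_trans _ _ (`|A j| * v / (Num.sqrt c0 * Num.sqrt v) ^+ j.+1)).
    apply: ler_pM => //; rewrite ?invr_ge0 ?exprn_ge0 ?(ltW s_gt0)//.
    rewrite lef_pV2 ?posrE ?exprn_gt0 ?mulr_gt0//.
    by rewrite lerXn2r// nnegrE ltW// mulr_gt0.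
  rewrite le_eqVlt; apply/orP; left; apply/eqP.
  rewrite exprMn -{1}(sqr_sqrtr (ltW v0)) /rho exprVn.
  have -> : Num.sqrt v ^+ j.+1 = Num.sqrt v ^+ 2 * Num.sqrt v ^+ (j.+1 - 2).
    by rewrite -exprD subnKC// ltnW.
  by field; rewrite !expf_neq0 ?lt0r_neq0.
- by move=> i; rewrite -moment1 standardized_recursion.
Qed.

Theorem theorem3p8 (R : realType) (d : nat) (hd b1 b2 eps : R)
    (d_gt0 : (0 < d)%N)
    (hd_gt0 : 0 < hd) (b1_gt0 : 0 < b1) (b2_gt0 : 0 < b2)
    (eps_gt0 : 0 < eps) (eps_lt1 : eps < 1)
    (decay : cumulant_decay d hd b1 b2 eps)
    (beta h : R) (beta_gt0 : 0 < beta)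
    (regime : in_regime hd b1 b2 beta h)
    (mu : probability (config d) R) (mu_plus : is_plus_state beta h mu)
    (disp : measure_display) (Omega : measurableType disp)
    (P : probability Omega R) (N : {RV P >-> R})
    (N_normal : forall A : set R, measurable A ->
      distribution P N A = normal_prob 0 1 A) :
  forall k : nat, (4 <= k)%N -> ~~ odd k ->
  exists C1 : R, forall n : nat, (1 <= n)%N ->
    (`| 'E_mu[fun w => (normalized_magnetization mu n w ^+ k)%R]
        - 'E_P[fun t => (N t ^+ k)%R] |
     <= (C1 * (1 / (2 * n%:R + 1) ^+ d))%:E)%E.
Proof.
move=> k _ ek.
have eps01 : 0 < eps < 1 by rewrite eps_gt0.
(* One sequence of constants for the cumulants of all orders, chosen before [n]. *)
have [A HA] := choice (cumulant_box_bound eps01 (decay _ _ beta_gt0 regime _ mu_plus)).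
pose c0 : R := expR (- @flip_bound R d beta h) /
  (expR (@flip_bound R d beta h) * (3 ^ d)%:R).
have c0_gt0 : 0 < c0.
  by rewrite divr_gt0 ?mulr_gt0 ?expR_gt0// ltr0n expn_gt0.
have [D HD] := standardized_moment_comparison A c0_gt0 ek.
exists D => n _; pose S : config d -> R := magnetization n.
have bS : bounded_measurable S.
  have -> : S = fun w => \sum_(x <- box_seq n) spin R (w x).
    by apply/funext => w; exact: magnetizationE.
  by apply: bounded_measurable_sum => x; exact: bounded_measurable_spin.
have vE : ((2 * n + 1) ^ d)%:R = (2 * n%:R + 1) ^+ d :> R.
  by rewrite natrX natrD natrM.
have v1 : 1 <= ((2 * n + 1) ^ d)%:R :> R by rewrite ler1n expn_gt0 addn1.
have Vge : c0 * ((2 * n + 1) ^ d)%:R <= fine ('V_mu[S])%E.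
  by rewrite variance_moment//; exact: variance_ge.
have := HD _ _ mu S _ bS v1 Vge (fun j => HA j n).
rewrite (normal_variable_moment N_normal ek).
have bZ : bounded_measurable (fun w => normalized_magnetization mu n w ^+ k).
  by apply: bounded_measurableX; exact: standardized_bounded.
by rewrite (expectation_bounded mu bZ) vE -EFinB abse_EFin lee_fin mul1r.
Qed.
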